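(* Let $X_t$ be a regular one-dimensional diffusion with values in $D=(l,r)$ as in the context, with continuous drift and diffusion functions, let $\rho>0$, and let $g:D\to\mathbb{R}$ be differentiable with $g(x_0)>0$ for some $x_0\in D$. Let a pair $(H(x),p^* )$ be a solution to the free-boundary problem described in the context such that $H''(p^*{-}0)>g''(p^* )$ (where $g$ is twice differentiable at $p^*$), and suppose that one of the following conditions holds: 1) $(H(x),p^* )$ is the unique solution to the free-boundary problem; 2) there exist other solutions to the free-boundary problem, $H(x)\ge g(x)$ for $l<x<p^*$, and every other solution $(\tilde H(x),\tilde p)$ satisfies either (2a) $\tilde p<p^*$; or (2b) $\tilde p>p^*$, and for some $n>2$: $\tilde H^{(k)}(\tilde p{-}0)=g^{(k)}(\tilde p)$ for $k=2,\dots,n-1$, and $\tilde H^{(n)}(\tilde p{-}0)>g^{(n)}(\tilde p)$ (the derivatives involved being assumed to exist). Then $\tau_{p^*}$ is optimal in the problem $\sup_\tau\mathbf{E}^xg(X_\tau)e^{-\rho\tau}\mathbf{1}_{\{\tau<\infty\}}$ over the class $\mathcal{M}^l_{\rm th}$ (for all $x\in(l,r)$).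
   Context: $X_t$, $t\ge0$, is a (continuous) diffusion process with values in $D=(l,r)$, $-\infty\le l<r\le+\infty$, with infinitesimal generator $\mathbb{L}f(x)=a(x)f'(x)+\frac12\sigma^2(x)f''(x)$, where $a:D\to\mathbb{R}$ and $\sigma:D\to(0,\infty)$ are continuous. The process is regular: from any $x\in(l,r)$ it reaches any $y\in(l,r)$ in finite time with positive probability. $\mathbf{E}^x$ denotes expectation for $X_0=x$. $\psi\in C^2(l,r)$ denotes the increasing positive fundamental solution (unique up to a positive multiplicative constant) of $\mathbb{L}u=\rho u$ on $(l,r)$ associated with $X$; it satisfies $\mathbf{E}^xe^{-\rho T_p}=\psi(x)/\psi(p)$ for $x<p$, where $T_p=\inf\{t\ge0:X_t=p\}$. For $p\in(l,r)$, $\tau_p=\inf\{t\ge0: X_t\ge p\}$, and $\mathcal{M}^l_{\rm th}=\{\tau_p:\ p\in(l,r)\}$. Free-boundary problem: find a threshold $\bar p\in(l,r)$ and a bounded twice differentiable function $H(x)$, $l<x<\bar p$, such that $$\mathbb{L}H(x)=\rho H(x)\ \ (l<x<\bar p),\qquad H(\bar p-0)=g(\bar p),\qquad H'(\bar p-0)=g'(\bar p).$$ For given $\bar p$, such an $H$ has the form $H(x)=\frac{g(\bar p)}{\psi(\bar p)}\psi(x)$, $l<x<\bar p$.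
   Formalization: In (2b) it is additionally assumed that ψ is n times differentiable (two-sided) at p̃; with a and σ only continuous, ψ^{(n)} may jump at p̃, the left derivatives then say nothing to the right of p̃, and the claim can fail. *)

(* Defs.v *)
From HB Require Import structures.
From mathcomp Require Import all_boot all_order all_algebra.
From mathcomp Require Import all_classical all_reals all_analysis.
From mathcomp Require Import measurable_realfun.

Set Implicit Arguments.
Unset Strict Implicit.
Unset Printing Implicit Defensive.

Import Order.TTheory GRing.Theory Num.Theory.
Import numFieldNormedType.Exports.

Local Open Scope classical_set_scope.
Local Open Scope ring_scope.

Definition state_space (R : realType) (l r : \bar R) : set R :=
  [set x | (l < x%:E < r)%E].

Definition diff_op (R : realType) (a sigma f : R -> R) (x : R) : R :=
  a x * derive1 f x + sigma x ^+ 2 / 2 * derive1n 2 f x.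

(* Elements of C^2 with compact support in D, extended by 0 to the whole
   line. *)
Record C2_compact (R : realType) (D : set R) (f : R -> R) : Prop := {
  C2c_derivable1 : forall x, derivable f x 1 ;
  C2c_derivable2 : forall x, derivable (derive1 f) x 1 ;
  C2c_continuous : continuous (derive1n 2 f) ;
  C2c_support : exists c d : R,
    [/\ D c, D d & forall x, ~~ (c <= x <= d) -> f x = 0] }.

Section Process.
Context {d : measure_display} {T : measurableType d} {R : realType}.
(* Only the times t >= 0 are relevant. *)
Implicit Types (X : R -> T -> R) (tau : T -> \bar R).

Definition natural_filtration X (t : R) : set (set T) :=
  <<s [set A | exists u : R, exists B : set R,
        [/\ 0 <= u <= t, measurable B & A = X u @^-1` B]] >>.

Definition stopping_time X tau : Prop :=
  (forall w, (0 <= tau w)%E) /\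
  (forall t : R, 0 <= t -> natural_filtration X t [set w | (tau w <= t%:E)%E]).

(* The sigma-algebra of events prior to tau. *)
Definition prior_to X tau (A : set T) : Prop :=
  measurable A /\
  forall t : R, 0 <= t ->
    natural_filtration X t (A `&` [set w | (tau w <= t%:E)%E]).

(* P x is the law under X_0 = x; only x in D matters. *)
Definition strong_Markov (D : set R) (P : R -> probability T R) X : Prop :=
  forall (x : R) tau (A : set T) (t : R) (B : set R),
    D x -> stopping_time X tau -> prior_to X tau A -> 0 <= t -> measurable B ->
    P x (A `&` [set w | (tau w < +oo)%E /\ B (X (fine (tau w) + t) w)]) =
    (\int[P x]_(w in A `&` [set w | (tau w < +oo)%E])
       P (X (fine (tau w)) w) (X t @^-1` B))%E.

(* L f is the limit of (E^y f(X_t) - f(y)) / t as t decreases to 0. Convergence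
   is required only uniformly on compact intervals of D, which is implied by
   convergence in the supremum norm. *)
Definition has_generator (D : set R) (P : R -> probability T R) X
    (L : (R -> R) -> R -> R) : Prop :=
  forall f : R -> R, C2_compact D f ->
  forall c c' : R, D c -> D c' ->
  forall e : R, 0 < e ->
  \forall t \near 0^'+, forall y, c <= y <= c' ->
    `| (fine ('E_(P y)[fun w => f (X t w)])%E - f y) / t - L f y | <= e.

Record regular_diffusion (l r : \bar R) (a sigma : R -> R)
    (P : R -> probability T R) X : Prop := {
  drift_continuous : {within state_space l r, continuous a} ;
  sigma_continuous : {within state_space l r, continuous sigma} ;
  sigma_gt0 : forall x, state_space l r x -> 0 < sigma x ;
  process_measurable : forall t : R, 0 <= t -> measurable_fun setT (X t) ;
  paths_in_D : forall (t : R) w, 0 <= t -> state_space l r (X t w) ;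
  paths_continuous : forall w,
    {within [set t : R | 0 <= t], continuous (fun t => X t w)} ;
  law_measurable : forall A : set T, measurable A ->
    measurable_fun (state_space l r) (fun x => P x A) ;
  starts_at : forall x, state_space l r x -> P x [set w | X 0 w = x] = 1%E ;
  diffusion_Markov : strong_Markov (state_space l r) P X ;
  diffusion_generator :
    has_generator (state_space l r) P X (diff_op a sigma) ;
  diffusion_regular : forall x y, state_space l r x -> state_space l r y ->
    (0 < P x [set w | exists2 t : R, (0 <= t)%R & X t w = y])%E }.

Definition threshold_time X (p : R) (w : T) : \bar R :=
  ereal_inf [set t%:E | t in [set t : R | 0 <= t /\ p <= X t w]].

Definition threshold_class (l r : \bar R) X : set (T -> \bar R) :=
  [set threshold_time X p | p in state_space l r].

Definition payoff (P : R -> probability T R) X (g : R -> R) (rho x : R) tau :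
    \bar R :=
  'E_(P x)[(fun w => g (X (fine (tau w)) w) * expR (- (rho * fine (tau w)))
                     * \1_[set v | (tau v < +oo)%E] w)%R]%E.

Definition optimal_in (C : set (T -> \bar R)) (l r : \bar R)
    (P : R -> probability T R) X (g : R -> R) (rho : R) tau : Prop :=
  C tau /\
  forall x, state_space l r x ->
    payoff P X g rho x tau =
    ereal_sup [set payoff P X g rho x tau' | tau' in C].

End Process.

Section FreeBoundary.
Context {R : realType}.
Implicit Types (l r : \bar R) (a sigma g H psi : R -> R) (rho p : R).

(* Since the process stays in (l, r), such a psi is unique up to a positive
   factor and E^x exp (- rho T_p) = psi x / psi p for x < p. *)
Record increasing_fundamental l r a sigma rho psi : Prop := {
  fund_derivable1 : forall x, state_space l r x -> derivable psi x 1 ;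
  fund_derivable2 : forall x, state_space l r x -> derivable (derive1 psi) x 1 ;
  fund_continuous : {within state_space l r, continuous (derive1n 2 psi)} ;
  fund_gt0 : forall x, state_space l r x -> 0 < psi x ;
  fund_increasing : forall x y, state_space l r x -> state_space l r y ->
    x < y -> psi x < psi y ;
  fund_eq : forall x, state_space l r x ->
    diff_op a sigma psi x = rho * psi x }.

(* Only the values of H on (l, p) are relevant. *)
Record fb_solution l r a sigma rho g H p : Prop := {
  fb_threshold : state_space l r p ;
  fb_bounded : exists M : R, forall x, state_space l p%:E x -> `|H x| <= M ;
  fb_derivable1 : forall x, state_space l p%:E x -> derivable H x 1 ;
  fb_derivable2 : forall x, state_space l p%:E x -> derivable (derive1 H) x 1 ;
  fb_eq : forall x, state_space l p%:E x ->
    diff_op a sigma H x = rho * H x ;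
  fb_value : H x @[x --> p^'-] --> g p ;
  fb_smooth_fit : derive1 H x @[x --> p^'-] --> derive1 g p }.

Definition same_solution l H p (H' : R -> R) (p' : R) : Prop :=
  p = p' /\ forall x, state_space l p%:E x -> H x = H' x.

(* derive1n n f p is a genuine n-th derivative, n >= 1; derive1n k f is total,
   so the lower derivatives have to exist around p. *)
Definition times_derivable_at (n : nat) (f : R -> R) p : Prop :=
  (\forall x \near p, forall k, (k.+1 < n)%N -> derivable (derive1n k f) x 1) /\
  derivable (derive1n n.-1 f) p 1.

Definition times_derivable_left (n : nat) (f : R -> R) p : Prop :=
  \forall x \near p^'-, forall k, (k < n)%N -> derivable (derive1n k f) x 1.

(* H^{(n)}(p-0) > g^{(n)}(p) *)
Definition left_derivn_gt (n : nat) H g p : Prop :=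
  exists2 c : R, derive1n n H x @[x --> p^'-] --> c & derive1n n g p < c.

(* Besides those of H and g, the derivatives of psi at p are assumed to exist:
   H^{(k)}(p-0) stands for g(p) / psi(p) * psi^{(k)}(p). As a and sigma are only
   continuous, the higher left and right derivatives of psi at p could
   otherwise differ, and nothing would be known to the right of p. *)
Definition higher_order_fit psi H g p : Prop :=
  exists n : nat,
    (2 < n)%N /\
    [/\ times_derivable_at n psi p, times_derivable_at n g p,
        times_derivable_left n H p,
        (forall k, (2 <= k <= n.-1)%N ->
           derive1n k H x @[x --> p^'-] --> derive1n k g p)
      & left_derivn_gt n H g p].

End FreeBoundary.

(* Main.v *)
Require Import Defs.
From HB Require Import structures.
From mathcomp Require Import all_boot all_order all_algebra.
From mathcomp Require Import all_classical all_reals all_analysis.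
From mathcomp Require Import measurable_realfun.
From mathcomp Require Import ring.

Import Order.TTheory GRing.Theory Num.Theory.
Import numFieldNormedType.Exports.

Set Implicit Arguments.
Unset Strict Implicit.
Unset Printing Implicit Defensive.

Local Open Scope classical_set_scope.
Local Open Scope ring_scope.

(* With h = g / psi, the Laplace transform E^x exp(-rho tau_p) = psi(x) / psi(p) gives
   tau_p the payoff psi(x) h(max(p, x)), so tau_pstar is optimal for every x as soon as
   h <= h(pstar) on (l, pstar) and h is nonincreasing on [pstar, r). Bounded solutions of
   L H = rho H on (l, p) are multiples of psi, hence the free-boundary solutions are the
   critical points of h, and the condition on the derivatives of order n says that
   h < h(p) immediately to the right of the critical point p. A larger value of h to
   the right of pstar would force an interior minimum of h, that is, a critical point
   contradicting this.
   The Laplace transform is obtained from the generator alone: freeze the chain X_(k dt)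
   when it leaves [c, q]; the Markov property and E^y f(X_dt) = f(y) + dt L f(y) + o(dt),
   uniformly on [c, q], make exp(-rho k dt) u(X_(k dt)) a martingale up to a vanishing
   error when L u = rho u. Letting dt -> 0 and c -> l yields u(x) = u(q) E^x exp(-rho s_q),
   where s_q is the first time X exceeds q, and tau_p lies between s_q (q < p) and s_p. *)

(** * Functions of class C^2 *)

Section Calculus.
Context {R : realType}.
Implicit Types (f g : R -> R) (O : set R).

(** The generator is given on compactly supported functions of class C^2 only, and uniformly on
    compact intervals only. This is why time is discretised and why a solution [u] is multiplied by
    a cutoff. In the estimates this is absorbed by the boundedness of the cut-off function. In the
    limit, continuity of each path makes the overshoot over q vanish, while the minimum of the path
    over a compact time interval stays above l, so that exits below c disappear without any analysis
    of the boundary l. On paths that never exceed q the discount tends to 0 and [u] is bounded.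
    Errors add up linearly over the time horizon, which dictates the precision demanded of one step.
    A fine grid detects the hitting of an open half-line, hence the detour through s_q. Running the
    argument for an arbitrary bounded solution on (l, p), and not for psi alone, gives the
    proportionality of H and psi by eliminating the common factor E^x exp(-rho s_q); no uniqueness
    theory for an equation with merely continuous coefficients enters. *)

Lemma is_derive1_continuous f (x d : R) :
  is_derive x (1 : R) f d -> {for x, continuous f}.
Proof.
by case=> df _; apply/differentiable_continuous/derivable1_diffP.
Qed.

Lemma derivable_is_derive1 f (x : R) :
  derivable f x 1 -> is_derive x (1 : R) f (derive1 f x).
Proof. by move=> df; rewrite derive1E; exact: derivableP. Qed.

Lemma is_derive1_derive1 f (x d : R) :
  is_derive x (1 : R) f d -> derive1 f x = d.
Proof. by move=> df; rewrite derive1E derive_val. Qed.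

(** Explicit witnesses for the derivatives turn each closure property into a formula to
    differentiate. Continuity of [f2] is at the points of [O], not merely within [O]. *)
Definition C2_on O f := exists f1 f2 : R -> R,
  [/\ forall x, O x -> is_derive x (1 : R) f (f1 x),
      forall x, O x -> is_derive x (1 : R) f1 (f2 x)
    & forall x, O x -> {for x, continuous f2}].

Lemma C2_onS O O' f : O `<=` O' -> C2_on O' f -> C2_on O f.
Proof.
move=> OO' [f1 [f2 [h1 h2 h3]]]; exists f1, f2.
by split=> x /OO'; [exact: h1|exact: h2|exact: h3].
Qed.

Lemma C2_onM O f g : C2_on O f -> C2_on O g -> C2_on O (fun x => f x * g x).
Proof.
move=> [f1 [f2 [hf1 hf2 hf3]]] [g1 [g2 [hg1 hg2 hg3]]].
exists (fun x => f x * g1 x + g x * f1 x),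
  (fun x => (f x * g2 x + g1 x * f1 x) + (g x * f2 x + f1 x * g1 x)).
split=> x Ox.
- have df := hf1 x Ox; have dg := hg1 x Ox; exact: is_deriveM.
- have df := hf1 x Ox; have dg := hg1 x Ox.
  have df1 := hf2 x Ox; have dg1 := hg2 x Ox.
  exact: (is_deriveD (is_deriveM df dg1) (is_deriveM dg df1)).
- have cf := is_derive1_continuous (hf1 x Ox).
  have cf1 := is_derive1_continuous (hf2 x Ox).
  have cg := is_derive1_continuous (hg1 x Ox).
  have cg1 := is_derive1_continuous (hg2 x Ox).
  have cf2 := hf3 x Ox; have cg2 := hg3 x Ox.
  by apply: cvgD; apply: cvgD; apply: cvgM.
Qed.

Lemma C2_on_comp O f g : C2_on setT f -> C2_on O g -> C2_on O (f \o g).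
Proof.
move=> [f1 [f2 [hf1 hf2 hf3]]] [g1 [g2 [hg1 hg2 hg3]]].
exists (fun x => f1 (g x) * g1 x),
  (fun x => f1 (g x) * g2 x + g1 x * (f2 (g x) * g1 x)).
split=> x Ox.
- exact: (is_derive1_comp (hf1 _ I) (hg1 x Ox)).
- have := is_derive1_comp (hf2 (g x) I) (hg1 x Ox).
  by move=> h; exact: (is_deriveM h (hg2 x Ox)).
- have cg := is_derive1_continuous (hg1 x Ox).
  have cg1 := is_derive1_continuous (hg2 x Ox).
  have cf1 := is_derive1_continuous (hf2 (g x) I).
  have cf2 := hf3 (g x) I; have cg2 := hg3 x Ox.
  have c1 : {for x, continuous (f1 \o g)} by apply: continuous_comp.
  have c2 : {for x, continuous (f2 \o g)} by apply: continuous_comp.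
  by apply: cvgD; apply: cvgM => //; apply: cvgM.
Qed.

Lemma C2_on_affine O (c e : R) : C2_on O (fun x => c * x + e).
Proof.
exists (cst c), (cst 0); split=> x _; last exact: cst_continuous.
  have h := is_deriveD (is_deriveM (is_derive_cst c x 1) (is_derive_id x (1 : R)))
    (is_derive_cst e x 1).
  apply: (is_derive_eq h).
  by rewrite /= scaler0 !addr0 [_ *: _]mulr1.
exact: is_derive_cst.
Qed.

(** The open sets [O] and the complement of [K] cover the line. The extension is locally [f] on the
    former and locally 0 on the latter, and on their overlap the derivatives of [f] vanish as
    well. *)
Lemma C2_on_extend O (K : set R) f : open O -> closed K -> K `<=` O ->
  (forall x, O x -> ~ K x -> f x = 0) -> C2_on O f ->
  C2_on setT (fun x => if `[< O x >] then f x else 0).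
Proof.
move=> oO cK KO f0 [f1 [f2 [h1 h2 h3]]].
have nO x : O x -> \forall y \near x, O y by move=> Ox; exact: open_nbhs_nbhs.
have nK x : ~ K x -> \forall y \near x, ~ K y.
  by move=> Kx; apply: open_nbhs_nbhs; split => //; exact: closed_openC.
have d0 g g1 : (forall x, O x -> ~ K x -> g x = 0) ->
    (forall x, O x -> is_derive x (1 : R) g (g1 x)) ->
    forall x, O x -> ~ K x -> g1 x = 0.
  move=> g0 hg x Ox Kx.
  rewrite -(is_derive1_derive1 (hg x Ox)); apply: is_derive1_derive1.
  apply: (@near_eq_is_derive _ _ _ (cst 0)).
  near=> y; rewrite g0 //; [near: y; exact: nO|near: y; exact: nK].
have f10 := d0 _ _ f0 h1; have f20 := d0 _ _ f10 h2.
have near_ext g x : (forall x, O x -> ~ K x -> g x = 0) ->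
    (O x -> \forall y \near x, g y = if `[< O y >] then g y else 0) /\
    (~ O x -> \forall y \near x, 0 = if `[< O y >] then g y else 0).
  move=> g0; split=> Ox; near=> y.
    by rewrite asboolT //; near: y; exact: nO.
  case: asboolP => // Oy; rewrite g0 //.
  by near: y; apply: nK => /KO.
have ext_der g g1 : (forall x, O x -> ~ K x -> g x = 0) ->
    (forall x, O x -> is_derive x (1 : R) g (g1 x)) ->
    forall x, is_derive x (1 : R) (fun x => if `[< O x >] then g x else 0)
      (if `[< O x >] then g1 x else 0).
  move=> g0 hg x; case: (asboolP (O x)) => Ox.
    exact: (near_eq_is_derive ((near_ext g x g0).1 Ox) (hg x Ox)).
  apply: (@near_eq_is_derive _ _ _ (cst 0)).
  exact: ((near_ext g x g0).2 Ox).
exists (fun x => if `[< O x >] then f1 x else 0),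
  (fun x => if `[< O x >] then f2 x else 0); split=> x _.
- exact: ext_der.
- exact: ext_der.
- rewrite /prop_for /continuous_at; case: (asboolP (O x)) => Ox.
    apply: cvg_trans (h3 x Ox); apply: near_eq_cvg.
    exact: ((near_ext f2 x f20).1 Ox).
  have h : cst (0 : R) y @[y --> x] --> (0 : R) by exact: cvg_cst.
  apply: cvg_trans h; apply: near_eq_cvg.
  exact: ((near_ext f2 x f20).2 Ox).
Unshelve. all: by end_near. Qed.

Lemma is_derive_pospart_exp (n : nat) (x : R) :
  is_derive x (1 : R) (fun t => Num.max 0 t ^+ n.+2)
    (n.+2%:R * Num.max 0 x ^+ n.+1).
Proof.
have [x0|x0|->] := ltgtP x 0.
- rewrite expr0n mulr0.
  apply: (@near_eq_is_derive _ _ _ (cst 0)).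
  near=> y; rewrite max_l ?expr0n//; apply/ltW; near: y; exact: lt_nbhsl.
- have h := is_deriveX n.+2 (is_derive_id x (1 : R)).
  have e : \forall y \near x, (id ^+ n.+2 : R -> R) y = Num.max 0 y ^+ n.+2.
    near=> y; rewrite max_r; first by rewrite exprfctE.
    by apply/ltW; near: y; exact: lt_nbhsr.
  apply: (is_derive_eq (near_eq_is_derive e h)).
  by rewrite /= [_ *: _]mulr1.
- rewrite expr0n mulr0.
  (* At the kink the difference quotient is at most |h| in absolute value once |h| <= 1, the
     exponent being at least 2. *)
  have h : h^-1 *: ((fun t : R => Num.max 0 t ^+ n.+2) (h *: (1 : R) + 0) -
        Num.max 0 0 ^+ n.+2) @[h --> 0^'] --> (0 : R).
    apply/cvgr0Pnorm_lt => e e0; near=> h.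
    have h0 : h != 0 by near: h; exact: nbhs_dnbhs_neq.
    rewrite maxxx expr0n subr0 addr0 [h *: _]mulr1 [_ *: _]mulrC exprSr -mulrA.
    apply: (@le_lt_trans _ _ `|h|); last first.
      near: h; apply: dnbhs0_lt => //.
    have m1 : `|Num.max 0 h| <= 1.
      apply: (@le_trans _ _ `|h|).
        by case: (leP 0 h) => h1; rewrite ?normr0.
      near: h; apply: dnbhs0_le => //.
    rewrite normrM normrX exprS -[leRHS]mulr1 -mulrA.
    have mh : `|Num.max 0 h| <= `|h| by case: (leP 0 h) => h1; rewrite ?normr0.
    apply: ler_pM => //.
    apply: mulr_ile1 => //; first exact: exprn_ile1.
    by rewrite normrM normfV ler_pdivrMr ?normr_gt0 // mul1r.
  split; first by apply/cvg_ex; exists 0.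
  by apply: cvg_lim.
Unshelve. all: by end_near. Qed.

(** The cube is the least power of the positive part that is of class C^2. The cutoffs are built
    from it by composition and products. *)
Lemma C2_pospart3 : C2_on setT (fun t : R => Num.max 0 t ^+ 3).
Proof.
exists (fun t => 3 * Num.max 0 t ^+ 2), (fun t => 3 * (2 * Num.max 0 t)).
split=> x _.
- exact: is_derive_pospart_exp.
- have h := is_derive_pospart_exp 0 x; rewrite expr1 in h.
  apply: (is_derive_eq (is_deriveM (is_derive_cst (3 : R) x (1 : R)) h)).
  by rewrite /= scaler0 addr0.
- apply: cvgM; first exact: cvg_cst.
  apply: cvgM; first exact: cvg_cst.
  by apply: continuous_max; [exact: cst_continuous|exact: cvg_id].
Qed.

Lemma cutoff_exists (c' c b b' : R) : c' < c -> b < b' -> exists chi : R -> R,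
  [/\ C2_on setT chi, forall x, 0 <= chi x <= 1,
      forall x, c <= x <= b -> chi x = 1
    & forall x, ~~ (c' <= x <= b') -> chi x = 0].
Proof.
move=> cc bb.
pose m t : R := Num.max 0 t ^+ 3.
(* s is of class C^2, equal to 1 on ]-oo, 0] and to 0 on [1, +oo[ *)
pose s t := m (1 - m t).
have Cs : C2_on setT s.
  have -> : s = m \o ((fun y => - 1 * y + 1) \o m).
    by apply/funext => t; rewrite /s /= mulN1r addrC.
  apply: C2_on_comp C2_pospart3 _; apply: C2_on_comp; first exact: C2_on_affine.
  exact: C2_pospart3.
have m0 t : t <= 0 -> m t = 0 by move=> t0; rewrite /m max_l // expr0n.
have m1 : m 1 = 1 by rewrite /m max_r // expr1n.
have mge0 t : 0 <= m t by rewrite exprn_ge0 // le_max lexx.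
have mle1 t : t <= 1 -> m t <= 1.
  by move=> t1; rewrite /m exprn_ile1 ?le_max ?lexx // ge_max ler01.
have s1 t : t <= 0 -> s t = 1 by move=> t0; rewrite /s (m0 t) // subr0.
have s0 t : 1 <= t -> s t = 0.
  move=> t1; rewrite /s m0 // subr_le0 /m exprn_ege1 // le_max t1 orbT //.
have s01 t : 0 <= s t <= 1 by rewrite mge0 /= mle1 // gerBl.
(* The first factor falls from 1 to 0 as x runs from b up to b', the second as x runs from c down to
   c'. *)
exists (fun x => s ((b' - b)^-1 * x + - (b / (b' - b))) *
              s (- (c - c')^-1 * x + c / (c - c'))); split.
- by apply: C2_onM; apply: (@C2_on_comp _ s) => //; exact: C2_on_affine.
- move=> x; have /andP[a1 a2] := s01 ((b' - b)^-1 * x + - (b / (b' - b))).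
  have /andP[a3 a4] := s01 (- (c - c')^-1 * x + c / (c - c')).
  by rewrite mulr_ge0 //= mulr_ile1.
- move=> x /andP[cx xb]; rewrite !s1 ?mulr1 //.
    by rewrite mulNr addrC [_^-1 * _]mulrC -mulrBl pmulr_lle0 ?invr_gt0 ?subr_gt0 // subr_le0.
  by rewrite mulrC -mulrBl pmulr_lle0 ?invr_gt0 ?subr_gt0 // subr_le0.
- move=> x; rewrite negb_and -!ltNge => /orP[xc|bx].
    rewrite [X in _ * X]s0 ?mulr0 //.
    rewrite mulNr addrC [_^-1 * _]mulrC -mulrBl ler_pdivlMr ?subr_gt0 // mul1r.
    by rewrite lerD2l lerN2 ltW.
  rewrite s0 ?mul0r //.
  by rewrite mulrC -mulrBl ler_pdivlMr ?subr_gt0 // mul1r lerD2r ltW.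
Qed.

Lemma C2_on_compact (D : set R) f (c d : R) : C2_on setT f -> D c -> D d ->
  (forall x, ~~ (c <= x <= d) -> f x = 0) -> C2_compact D f.
Proof.
move=> [f1 [f2 [h1 h2 h3]]] Dc Dd f0.
have e1 : derive1 f = f1.
  by apply/funext => x; exact: is_derive1_derive1 (h1 x I).
have e2 : derive1n 2 f = f2.
  rewrite /derive1n /= e1.
  by apply/funext => x; exact: is_derive1_derive1 (h2 x I).
split.
- by move=> x; have [] := h1 x I.
- by move=> x; rewrite e1; have [] := h2 x I.
- by rewrite e2 => x; exact: h3.
- by exists c, d.
Qed.

Lemma diff_op_near (a sigma f g : R -> R) (x : R) :
  (\forall y \near x, f y = g y) -> diff_op a sigma f x = diff_op a sigma g x.
Proof.
move=> fg; rewrite /diff_op /derive1n /=.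
have e1 : \forall y \near x, derive1 f y = derive1 g y.
  have := nbhs_interior fg; apply: filterS => y fgy.
  by rewrite !derive1E; exact: near_eq_derive.
rewrite (nbhs_singleton e1); congr (_ + _ * _).
by rewrite !derive1E; exact: near_eq_derive.
Qed.

End Calculus.

(** * Smooth fit and local comparison *)

Section HigherOrderFit.
Context {R : realType}.
Implicit Types (f g u G H psi : R -> R) (p : R).

Lemma is_derive1_gt0_sign f p (d : R) :
  is_derive p (1 : R) f d -> 0 < d -> f p = 0 ->
  exists2 e : R, 0 < e &
    forall x, x != p -> `|x - p| < e -> 0 < f x * (x - p).
Proof.
move=> [df dd] d0 fp0.
have : h^-1 *: ((f \o shift p) (h *: (1 : R)) - f p) @[h --> 0^'] --> d.
  by rewrite -dd; exact: df.
move=> /cvgr_gt /(_ 0 d0) /nbhs_ballP[e /= e0 he]; exists e => // x xp xe.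
have xp0 : x - p != 0 by rewrite subr_eq0.
have := he (x - p); rewrite /ball /= sub0r normrN xe => /(_ isT xp0).
rewrite fp0 subr0 [_ *: (1 : R)]mulr1 subrK [_ *: _]mulrC.
have x2 : 0 < (x - p) ^+ 2 by rewrite lt_def sqrf_eq0 xp0 sqr_ge0.
by move=> h; have := mulr_gt0 h x2; rewrite expr2 mulrA divfK.
Qed.

(** A form of the mean value theorem that can be iterated: the intermediate point lies on the same
    side of p as x and in the same ball, so it satisfies the hypotheses placed on x and no radius
    has to shrink. *)
Lemma MVT_between f f1 p (x e : R) : x != p -> `|x - p| < e ->
  (forall y, `|y - p| < e -> is_derive y (1 : R) f (f1 y)) ->
  exists c, [/\ c != p, `|c - p| < e, 0 < (c - p) * (x - p) &
    f x - f p = f1 c * (x - p)].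
Proof.
move=> xp xe hf.
have cont (a b : R) : (forall y, y \in `[a, b]%R -> `|y - p| < e) ->
    {within `[a, b], continuous f}.
  move=> ab; apply: derivable_within_continuous => y /ab ye.
  by have [] := hf y ye.
have [px|px|/eqP] := ltgtP p x; last by rewrite eq_sym (negbTE xp).
- have ye y : y \in `[p, x]%R -> `|y - p| < e.
    rewrite in_itv /= => /andP[y1 y2]; apply: le_lt_trans xe.
    by rewrite !ger0_norm ?subr_ge0 ?(ltW px) // lerD2r.
  have [c cpx ->] := MVT px (fun y hy => hf y (ye y (subset_itv_oo_cc hy)))
    (cont _ _ ye).
  have ce := ye _ (subset_itv_oo_cc cpx).
  move: cpx; rewrite in_itv /= => /andP[c1 c2].
  by exists c; split; rewrite ?gt_eqF // mulr_gt0 // subr_gt0.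
- have ye y : y \in `[x, p]%R -> `|y - p| < e.
    rewrite in_itv /= => /andP[y1 y2]; apply: le_lt_trans xe.
    by rewrite !ler0_norm ?subr_le0 ?(ltW px) // lerN2 lerD2r.
  have [c cpx hc] := MVT px (fun y hy => hf y (ye y (subset_itv_oo_cc hy)))
    (cont _ _ ye).
  have ce := ye _ (subset_itv_oo_cc cpx).
  move: cpx; rewrite in_itv /= => /andP[c1 c2].
  exists c; split; rewrite ?lt_eqF //.
    by rewrite nmulr_lgt0 subr_lt0.
  by rewrite -opprB hc -mulrN opprB.
Qed.

(** By the mean value theorem, left difference quotients at p are values of [f1] just before p. This
    identifies the one-sided limit H^(n)(p-0) with the two-sided n-th derivative at p of the
    multiple of psi that coincides with H left of p. *)
Lemma is_derive1_left_limit f f1 p (d c : R) :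
  is_derive p (1 : R) f d -> (\forall x \near p^'-, is_derive x (1 : R) f (f1 x)) ->
  f1 x @[x --> p^'-] --> c -> d = c.
Proof.
move=> [df dd] fl f1c; apply/eqP/negPn/negP => dc.
have e0 : 0 < `|d - c| / 2 by rewrite divr_gt0 // normr_gt0 subr_eq0.
have : h^-1 *: ((f \o shift p) (h *: (1 : R)) - f p) @[h --> 0^'] --> d.
  by rewrite -dd; exact: df.
move=> /cvgrPdist_lt /(_ _ e0) /nbhs_ballP[e1 /= e10 h1].
have [e2 /= e20 h2] := fl.
move: f1c => /cvgrPdist_lt /(_ _ e0) [e3 /= e30 h3].
pose e := Num.min e1 (Num.min e2 e3).
have ee0 : 0 < e by rewrite !lt_min e10 e20.
pose x := p - e / 2.
have xp : x < p by rewrite ltrBlDr ltrDl divr_gt0.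
have ye y : x <= y -> y < p -> `|p - y| < e.
  move=> xy yp; rewrite gtr0_norm ?subr_gt0 // ltrBlDr -ltrBlDl.
  by apply: lt_le_trans xy; rewrite ltrD2l ltrN2 ltr_pdivrMr // ltr_pMr // ltr1n.
have xi : x != p by rewrite lt_eqF.
have [ex1 ex2 ex3] : [/\ e <= e1, e <= e2 & e <= e3].
  by rewrite /e !ge_min !lexx ?orbT.
have d2 y : y \in `]x, p[%R -> is_derive y (1 : R) f (f1 y).
  by rewrite in_itv /= => /andP[xy yp]; apply: h2 => //; apply: lt_le_trans ex2;
    apply: ye; rewrite ?ltW.
have [|y] := MVT xp d2.
  apply: derivable_within_continuous => y; rewrite in_itv /= => /andP[xy].
  rewrite le_eqVlt => /predU1P[-> //|yp].
  by have [] := h2 y (lt_le_trans (ye _ xy yp) ex2) yp.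
rewrite in_itv /= => /andP[xy yp] hy.
have := h3 y (lt_le_trans (ye _ (ltW xy) yp) ex3) yp.
have := h1 (x - p); rewrite /ball /= sub0r normrN distrC.
move=> /(_ (lt_le_trans (ye _ (lexx x) xp) ex1)); rewrite subr_eq0 => /(_ xi).
have hy' : f x - f p = f1 y * (x - p) by rewrite -opprB hy -mulrN opprB.
rewrite [_ *: (1 : R)]mulr1 subrK [_ *: _]mulrC hy' mulfK ?subr_eq0 //.
move=> a1 a2.
have : `|d - c| < `|d - c| / 2 + `|d - c| / 2.
  apply: le_lt_trans (ltrD a1 a2); rewrite [in X in _ <= _ + X]distrC.
  by rewrite -(subrKA (f1 y)); exact: ler_normD.
by rewrite -splitr ltxx.
Qed.

(** [G k] stands for the k-th derivative of [G 0]. The sign of [G n] near p comes from its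
    derivative at p, and the mean value theorem carries it down to [G 0]. Each descent multiplies by
    x - p: to the right positivity persists, to the left the sign alternates, and for [n = 1] the
    two sign changes cancel. *)
Lemma iterated_derive_gt0 (G : nat -> R -> R) (n : nat) p (c : R) :
  (forall k, (k <= n)%N -> G k p = 0) ->
  (\forall x \near p, forall k, (k < n)%N -> is_derive x (1 : R) (G k) (G k.+1 x)) ->
  is_derive p (1 : R) (G n) c -> 0 < c ->
  exists2 e : R, 0 < e &
    (forall x, p < x < p + e -> 0 < G 0%N x) /\
    (n = 1%N -> forall x, p - e < x < p -> 0 < G 0%N x).
Proof.
move=> G0 Gd Gn c0.
have [e1 e10 hG] : exists2 e, 0 < e & forall x, `|x - p| < e ->
    forall k, (k < n)%N -> is_derive x (1 : R) (G k) (G k.+1 x).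
  have /nbhs_ballP[e /= e0 he] := Gd; exists e => // x xe.
  by apply: he; rewrite /ball /= distrC.
have [e2 e20 hGn] := is_derive1_gt0_sign Gn c0 (G0 n (leqnn n)).
have step k : (k < n)%N -> forall x, x != p -> `|x - p| < Num.min e1 e2 ->
    exists y, [/\ y != p, `|y - p| < Num.min e1 e2, 0 < (y - p) * (x - p) &
      G k x = G k.+1 y * (x - p)].
  move=> kn x xp xe; have /(_ (G k) (G k.+1)) := MVT_between xp xe _.
  case=> [y ye|y [y1 y2 y3 y4]].
    by move: ye; rewrite lt_min => /andP[ye _]; exact: hG.
  by exists y; split => //; rewrite -y4 G0 ?subr0 // ltnW.
exists (Num.min e1 e2); first by rewrite lt_min e10.
have right x : p < x < p + Num.min e1 e2 -> x - p > 0 /\ `|x - p| < Num.min e1 e2.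
  move=> /andP[x1 x2]; rewrite subr_gt0 x1 gtr0_norm ?subr_gt0 // ltrBlDl //.
split.
(* Induction on the number [j] of orders already descended from [n]. *)
- have main j : (j <= n)%N -> forall x, 0 < x - p -> `|x - p| < Num.min e1 e2 ->
      0 < G (n - j)%N x.
    elim: j => [_ x xp xe|j IH jn x xp xe].
      have xp1 : x != p by rewrite gt_eqF // -subr_gt0.
      move: xe; rewrite lt_min subn0 => /andP[_ xe]; have := hGn x xp1 xe.
      by rewrite pmulr_lgt0.
    have [||y [y1 y2 y3 ->]] := step (n - j.+1)%N _ x _ xe.
    - by rewrite subnSK // leq_subr.
    - by rewrite gt_eqF // -subr_gt0.
    rewrite mulr_gt0 // -subSn // subSS; apply: IH => //; first exact: ltnW.
    by rewrite pmulr_lgt0 in y3.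
  by move=> x /right[x1 x2]; have := main n (leqnn n) x x1 x2; rewrite subnn.
- move=> n1 x /andP[x1 x2].
  have xp0 : x - p < 0 by rewrite subr_lt0.
  have xe : `|x - p| < Num.min e1 e2 by rewrite ltr0_norm // opprB ltrBlDl -ltrBlDr.
  have [||y [y1 y2 y3 ->]] := step 0%N _ x _ xe; rewrite ?n1 ?lt_eqF //.
  have yp : y - p < 0 by rewrite nmulr_lgt0 in y3.
  have := hGn y y1; move: y2; rewrite lt_min => /andP[_ y2] /(_ y2).
  by rewrite n1 nmulr_lgt0 // => h; rewrite nmulr_lgt0.
Qed.

End HigherOrderFit.

Section SmoothFit.
Context {R : realType}.
Implicit Types (f g u G H psi : R -> R) (p kappa : R).

(** Left neighbourhoods of p are open near each of their points, so an identity valid just left of p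
    can be differentiated there. *)
Lemma near_left_near p (Q : R -> Prop) : (\forall x \near p^'-, Q x) ->
  \forall x \near p^'-, \forall y \near x, Q y.
Proof.
move=> [e /= e0 he]; exists e => //= x xe xp.
near=> y; apply: he; last by near: y; exact: lt_nbhsl.
have yp : y < p by near: y; exact: lt_nbhsl.
rewrite /= gtr0_norm ?subr_gt0 // ltrBlDr -ltrBlDl; near: y; apply: lt_nbhsr.
by move: xe; rewrite /= gtr0_norm ?subr_gt0 // ltrBlDr -ltrBlDl.
Unshelve. all: by end_near. Qed.

Lemma derive1n_left_scale psi H p kappa n :
  (\forall x \near p, forall k, (k.+1 < n)%N -> derivable (derive1n k psi) x 1) ->
  (\forall x \near p^'-, H x = kappa * psi x) ->
  forall k, (k < n)%N ->
  \forall x \near p^'-, derive1n k H x = kappa * derive1n k psi x.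
Proof.
move=> dpsi HE; elim=> [//|k IH kn].
have dpsil : \forall x \near p^'-, forall k, (k.+1 < n)%N ->
    derivable (derive1n k psi) x 1 by exact: cvg_within dpsi.
have := near_left_near (IH (ltnW kn)) => IHn.
near=> x.
rewrite !derive1nS.
have dx : derivable (derive1n k psi) x 1.
  by near: x; apply: filterS dpsil => x; exact.
apply: is_derive1_derive1.
apply: (@near_eq_is_derive _ _ _ (fun y => kappa * derive1n k psi y)).
  by near: x; apply: filterS IHn => x; apply: filterS => y ->.
have := is_deriveM (is_derive_cst kappa x (1 : R)) (derivable_is_derive1 dx).
by move=> h; apply: (is_derive_eq h); rewrite /= scaler0 addr0.
Unshelve. all: by end_near. Qed.

(** [H] carries information on the left of p only, while the gap is wanted on the right too, where
    [kappa * psi] continues it. The difference [G 0] has vanishing derivatives at p up to order n -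
    1, and its n-th derivative there is c - g^(n)(p) > 0. *)
Lemma smooth_fit_gap psi g H p kappa n : (1 < n)%N ->
  times_derivable_at n psi p -> times_derivable_at n g p ->
  times_derivable_left n H p ->
  (\forall x \near p^'-, H x = kappa * psi x) ->
  kappa * psi p = g p -> kappa * derive1 psi p = derive1 g p ->
  (forall k, (2 <= k <= n.-1)%N -> derive1n k H x @[x --> p^'-] --> derive1n k g p) ->
  left_derivn_gt n H g p ->
  exists2 e : R, 0 < e &
    (forall x, p < x < p + e -> g x < kappa * psi x) /\
    (n = 2%N -> forall x, p - e < x < p -> g x < kappa * psi x).
Proof.
move=> n1 [psin psip] [gn gp] Hn HE v0 v1 vk [c Hc gc].
have Hk := derive1n_left_scale psin HE.
pose G k x := kappa * derive1n k psi x - derive1n k g x.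
have cst_der f x : derivable f x 1 ->
    is_derive x (1 : R) (fun y => kappa * f y) (kappa * derive1 f x).
  move=> df; have := is_deriveM (is_derive_cst kappa x (1 : R)) (derivable_is_derive1 df).
  by move=> h; apply: (is_derive_eq h); rewrite /= scaler0 addr0.
have G_der k x : derivable (derive1n k psi) x 1 -> derivable (derive1n k g) x 1 ->
    is_derive x (1 : R) (G k) (G k.+1 x).
  move=> d1 d2; rewrite /G !derive1nS.
  exact: (is_deriveB (cst_der _ _ d1) (derivable_is_derive1 d2)).
have pn : (n.-1 < n)%N by rewrite prednK // ltnW.
have psik k : (k <= n.-1)%N -> {for p, continuous (derive1n k psi)}.
  rewrite leq_eqVlt => /predU1P[->|kn].
    exact: is_derive1_continuous (derivable_is_derive1 psip).
  have kn' : (k.+1 < n)%N by rewrite -(prednK (ltnW n1)) ltnS.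
  exact: is_derive1_continuous (derivable_is_derive1 (nbhs_singleton psin k kn')).
have G0 k : (k <= n.-1)%N -> G k p = 0.
  move=> kn; apply/eqP; rewrite subr_eq0; apply/eqP.
  (* Orders 0 and 1 are value matching and smooth fit. From order 2 on, the left limit of H^(k) at p
     is computed in two ways. *)
  case: k kn => [//|[//|k]] kn.
  have kn' : (k.+2 < n)%N by apply: leq_ltn_trans pn.
  have h1 := vk k.+2 kn.
  have h2 : kappa * derive1n k.+2 psi x @[x --> p^'-] --> kappa * derive1n k.+2 psi p.
    by apply: cvg_at_left_filter; apply: cvgMr; exact: psik.
  apply: (@cvg_unique _ (@Rhausdorff R) _ _ _ _ h2).
  by apply: cvg_trans h1; apply: near_eq_cvg; exact: Hk.
have Gc : G n p = c - derive1n n g p.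
  congr (_ - _); have h1 := cst_der _ _ psip.
  rewrite -derive1nS prednK in h1; last exact: ltnW.
  apply: (is_derive1_left_limit h1 _ Hc).
  have := near_left_near (Hk _ pn) => h2; near=> x.
  apply: (@near_eq_is_derive _ _ _ (derive1n n.-1 H)).
    by near: x; exact: h2.
  have -> : derive1n n H x = derive1 (derive1n n.-1 H) x.
    by rewrite -derive1nS prednK // ltnW.
  apply: derivable_is_derive1; near: x; apply: filterS Hn => x; exact.
(* Applied at order [n.-1], since the n-th derivatives of [psi] and [g] are assumed to exist at p
   itself only. *)
have [|||e e0 [h1 h2]] := @iterated_derive_gt0 _ G n.-1 p (c - derive1n n g p) G0.
- apply: filterS2 psin gn => x d1 d2 k kn.
  have kn' : (k.+1 < n)%N by rewrite -(prednK (ltnW n1)) ltnS.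
  exact: G_der (d1 k kn') (d2 k kn').
- rewrite -Gc -[in G n](prednK (ltnW n1)); exact: G_der.
- by rewrite subr_gt0.
exists e => //; split=> [x /h1|n2 x xp].
  by rewrite subr_gt0.
have := h2 _ x xp; rewrite n2 => /(_ erefl).
by rewrite subr_gt0.
Unshelve. all: by end_near. Qed.

End SmoothFit.

(** * Monotonicity of g / psi *)

Section RatioMonotone.
Context {R : realType}.
Implicit Types (g psi : R -> R) (l r : \bar R).

Lemma state_space_itv l r (a b x : R) : state_space l r a -> state_space l r b ->
  a <= x <= b -> state_space l r x.
Proof.
rewrite /state_space /= => /andP[la _] /andP[_ br] /andP[ax xb].
by rewrite (lt_le_trans la) ?lee_fin //= (le_lt_trans _ br) ?lee_fin.
Qed.

(** The minimum of g / psi over [a, b] is attained, and [z1], [z2] keep it away from the end points.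
    With [k] its value, g - k psi is nonnegative on [a, b] and vanishes at the minimiser, so its
    derivative is 0 there; the quotient itself is never differentiated. *)
Lemma ratio_interior_min l r psi g (a b z1 z2 : R) :
  (forall x, state_space l r x -> derivable psi x 1) ->
  (forall x, state_space l r x -> derivable g x 1) ->
  (forall x, state_space l r x -> 0 < psi x) ->
  state_space l r a -> state_space l r b ->
  a <= z1 <= b -> a <= z2 <= b ->
  g z1 / psi z1 < g a / psi a -> g z2 / psi z2 < g b / psi b ->
  exists m, [/\ a < m < b, g m / psi m * derive1 psi m = derive1 g m &
    forall x, a <= x <= b -> g m / psi m <= g x / psi x].
Proof.
move=> dpsi dg psi0 Da Db az1 az2 h1 h2.
have Dx x : a <= x <= b -> state_space l r x by exact: state_space_itv.
have ab : a <= b by case/andP: az1; exact: le_trans.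
have ct : {within `[a, b], continuous (fun x => g x / psi x)}.
  apply: continuous_in_subspaceT => x /[1!inE]; rewrite /= in_itv /= => /Dx Dx1.
  have c1 := is_derive1_continuous (derivable_is_derive1 (dg x Dx1)).
  have c2 := is_derive1_continuous (derivable_is_derive1 (dpsi x Dx1)).
  by apply: cvgM => //; apply: cvgV => //; rewrite gt_eqF // psi0.
have [m mab hm] := EVT_min ab ct.
have {}hm x : a <= x <= b -> g m / psi m <= g x / psi x.
  by move=> xab; apply: hm; rewrite in_itv.
move: mab; rewrite in_itv /= => mab.
have ma : m != a.
  by apply/negP => /eqP ma; have := le_lt_trans (hm _ az1) h1; rewrite ma ltxx.
have mb : m != b.
  by apply/negP => /eqP mb; have := le_lt_trans (hm _ az2) h2; rewrite mb ltxx.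
have m_in : a < m < b by move/andP: mab => [m1 m2]; rewrite !lt_def ma m1 m2 eq_sym mb.
exists m; split => //.
set k := g m / psi m.
have der x : a < x < b -> is_derive x (1 : R) (fun y => g y - k * psi y)
    (derive1 g x - k * derive1 psi x).
  move=> /andP[x1 x2]; have Dx1 : state_space l r x by apply: Dx; rewrite !ltW.
  have h := is_deriveB (derivable_is_derive1 (dg x Dx1))
    (is_deriveM (is_derive_cst k x (1 : R)) (derivable_is_derive1 (dpsi x Dx1))).
  by apply: (is_derive_eq h); rewrite /= scaler0 addr0.
have hmin : is_derive m (1 : R) (fun y => g y - k * psi y) 0.
  apply: (derive1_at_min ab).
  - by move=> t; rewrite in_itv /= => /der[].
  - by rewrite in_itv.
  - move=> t; rewrite in_itv /= => /andP[t1 t2].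
    have tab : a <= t <= b by rewrite !ltW.
    have pm := psi0 m (Dx m mab); have pt := psi0 t (Dx t tab).
    by rewrite /k divfK ?gt_eqF // subrr subr_ge0 -ler_pdivlMr // hm.
have := is_derive1_derive1 (der m m_in); rewrite (is_derive1_derive1 hmin).
by move/esym/eqP; rewrite subr_eq0 => /eqP.
Qed.

Lemma ratio_nonincreasing l r psi g (p : R) :
  (forall x, state_space l r x -> derivable psi x 1) ->
  (forall x, state_space l r x -> derivable g x 1) ->
  (forall x, state_space l r x -> 0 < psi x) ->
  state_space l r p ->
  g p / psi p * derive1 psi p = derive1 g p ->
  (forall q, state_space l r q -> p <= q ->
    g q / psi q * derive1 psi q = derive1 g q ->
    exists2 e : R, 0 < e & forall x, q < x < q + e -> g x < g q / psi q * psi x) ->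
  forall x y, state_space l r y -> p <= x <= y -> g y / psi y <= g x / psi x.
Proof.
move=> dpsi dg psi0 Dp crit dec x y Dy /andP[px xy]; rewrite leNgt; apply/negP => hxy.
have below q b : state_space l r q -> state_space l r b -> p <= q -> q < b ->
    g q / psi q * derive1 psi q = derive1 g q ->
    exists2 z, q <= z <= b & g z / psi z < g q / psi q.
  move=> Dq Db pq qb cq; have [e e0 he] := dec q Dq pq cq.
  pose z := q + Num.min e (b - q) / 2.
  have m0 : 0 < Num.min e (b - q) by rewrite lt_min e0 subr_gt0.
  have m2 : Num.min e (b - q) / 2 < Num.min e (b - q).
    by rewrite ltr_pdivrMr // ltr_pMr // ltr1n.
  have qz : q < z by rewrite ltrDl divr_gt0.
  have zb : z <= b.
    by rewrite /z -lerBrDl (le_trans (ltW m2)) // ge_min lexx orbT.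
  have ze : z < q + e by rewrite ltrD2l (lt_le_trans m2) // ge_min lexx.
  exists z; first by rewrite ltW.
  rewrite ltr_pdivrMr ?he ?qz // psi0 //.
  by apply: (@state_space_itv l r q b) => //; rewrite ltW.
have py : p < y.
  rewrite lt_neqAle (le_trans px xy) andbT; apply/eqP => pey.
  have e : x = y by apply/eqP; rewrite eq_le xy -pey px.
  by move: hxy; rewrite e ltxx.
(* [z] prevents a minimum over [p, y] at p, and [x] prevents one at y. At the interior minimiser
   [m], a critical point, [below] produces a value smaller than the minimum. *)
have [z pz hz] := below p y Dp Dy (lexx p) py crit.
have [|m [/andP[pm my] cm hm]] :=
  ratio_interior_min dpsi dg psi0 Dp Dy pz _ hz hxy; first by rewrite px xy.
have Dm : state_space l r m.
  by apply: (state_space_itv Dp Dy); rewrite !ltW.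
have [w /andP[mw wy]] := below m y Dm Dy (ltW pm) my cm.
by rewrite ltNge hm // wy (le_trans (ltW pm)).
Qed.

End RatioMonotone.

(** * Test functions *)

Section TestFunctions.
Context {R : realType}.
Implicit Types (u a sigma : R -> R) (l r : \bar R).

Lemma state_space_open l r : open (state_space l r : set R).
Proof.
have -> : state_space l r = [set x : R | (l < x%:E)%E] `&` [set x : R | (x%:E < r)%E].
  by apply/seteqP; split=> x /=; [move/andP|move=> [h1 h2]; apply/andP].
by apply: openI; [exact: open_ereal_gt|exact: open_ereal_lt].
Qed.

Lemma lte_dense_EFin l (c : R) : (l < c%:E)%E -> exists2 c' : R, (l < c'%:E)%E & c' < c.
Proof.
case: l => [l| |] //=.
- rewrite lte_fin => lc; exists ((l + c) / 2); first by rewrite lte_fin midf_lt.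
  by rewrite midf_lt.
- by move=> _; exists (c - 1); rewrite ?ltNyr // ltrBlDr ltrDl.
Qed.

(** What [psi] and a solution [H] of the free-boundary problem share on (l, p): no condition is
    imposed at p, and boundedness replaces any boundary condition at l. *)
Record bounded_solution l a sigma (rho : R) u (p : R) : Prop := {
  bsol_bounded : exists M, forall x, state_space l p%:E x -> `|u x| <= M ;
  bsol_derivable1 : forall x, state_space l p%:E x -> derivable u x 1 ;
  bsol_derivable2 : forall x, state_space l p%:E x -> derivable (derive1 u) x 1 ;
  bsol_eq : forall x, state_space l p%:E x -> diff_op a sigma u x = rho * u x }.

(** Continuity of u'' is not part of being a solution; it is read off the equation, solved for u''
    thanks to sigma > 0. *)
Lemma bounded_solution_C2 l r a sigma rho u p :
  {within state_space l r, continuous a} ->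
  {within state_space l r, continuous sigma} ->
  (forall x, state_space l r x -> 0 < sigma x) ->
  (p%:E <= r)%E ->
  bounded_solution l a sigma rho u p -> C2_on (state_space l p%:E) u.
Proof.
move=> ca cs s0 pr [_ d1 d2 eu].
have sub : state_space l p%:E `<=` state_space l r.
  by move=> x /andP[lx xp]; apply/andP; split=> //; exact: lt_le_trans pr.
rewrite !continuous_open_subspace in ca cs; try exact: state_space_open.
exists (derive1 u), (fun x => (rho * u x - a x * derive1 u x) * (2 / sigma x ^+ 2)).
split=> x Ox.
- exact/derivable_is_derive1/d1.
- have sx := s0 x (sub x Ox).
  apply: (is_derive_eq (derivable_is_derive1 (d2 x Ox))).
  rewrite -(eu x Ox) /diff_op /derive1n /= addrAC subrr add0r.
  have sn : sigma x != 0 by rewrite gt_eqF.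
  by field.
- have xin : x \in state_space l r by rewrite inE; exact: sub.
  have cu := is_derive1_continuous (derivable_is_derive1 (d1 x Ox)).
  have cu1 := is_derive1_continuous (derivable_is_derive1 (d2 x Ox)).
  have cax := ca x xin; have csx := cs x xin.
  apply: cvgM; first apply: cvgB; try apply: cvgM => //; try exact: cvg_cst.
  apply: cvgV; first by rewrite expf_neq0 // gt_eqF // s0 //; exact: sub.
  exact: (cvgM csx csx).
Qed.

(** Multiplying [u] by a cutoff brings it within the scope of the generator, and keeps the bound [M]
    because the cutoff takes values in [0, 1]. *)
Lemma bounded_solution_test l r a sigma rho u p (c q : R) (M : R) :
  {within state_space l r, continuous a} ->
  {within state_space l r, continuous sigma} ->
  (forall x, state_space l r x -> 0 < sigma x) ->
  (p%:E <= r)%E -> bounded_solution l a sigma rho u p ->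
  (forall x, state_space l p%:E x -> `|u x| <= M) ->
  (l < c%:E)%E -> c <= q -> q < p ->
  exists f : R -> R, [/\ C2_compact (state_space l r) f,
    forall x, `|f x| <= M,
    forall x, c <= x <= q -> f x = u x
  & forall x, c <= x <= q -> diff_op a sigma f x = rho * f x].
Proof.
move=> ca cs s0 pr bu uM lc cq qp.
have Cu := bounded_solution_C2 ca cs s0 pr bu.
(* Two margins on each side, l < c2 < c1 < c and q < q1 < q2 < p. On [c1, q1], a neighbourhood of
   [c, q], f = u, so the operator takes the same values on both, at c and q included; f vanishes
   outside [c2, q2]. *)
have [c1 lc1 c1c] := lte_dense_EFin lc.
have [c2 lc2 c2c1] := lte_dense_EFin lc1.
pose q1 := (q + p) / 2; pose q2 := (q1 + p) / 2.
have [qq1 q1p] : q < q1 /\ q1 < p by rewrite !midf_lt.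
have [q1q2 q2p] : q1 < q2 /\ q2 < p by rewrite !midf_lt.
have [chi [Cchi chi01 chi1 chi0]] := cutoff_exists c2c1 q1q2.
pose O : set R := state_space l p%:E.
pose f x := if `[< O x >] then u x * chi x else 0.
have KO : `[c2, q2] `<=` O.
  move=> x; rewrite /= in_itv /= => /andP[x1 x2]; apply/andP; split.
    by rewrite (lt_le_trans lc2) // lee_fin.
  by rewrite lte_fin (le_lt_trans x2).
have M0 : 0 <= M.
  apply: le_trans (uM c2 _) => //; apply: KO; rewrite /= in_itv /= lexx.
  by rewrite !ltW // (lt_trans c2c1) // (lt_trans c1c) // (le_lt_trans cq) // (lt_trans qq1).
have fC : C2_on setT f.
  apply: (@C2_on_extend _ O `[c2, q2] (fun x => u x * chi x)) => //.
  - exact: state_space_open.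
  - exact: itv_closed.
  - move=> x _; rewrite /= in_itv /= => /negP xK.
    by rewrite chi0 ?mulr0.
  - by apply: C2_onM => //; exact: C2_onS Cchi.
have fu x : c1 <= x <= q1 -> f x = u x.
  move=> /andP[x1 x2]; rewrite /f asboolT ?chi1 ?mulr1 ?x1 //.
  by apply: KO; rewrite /= in_itv /= (le_trans (ltW c2c1)) // (le_trans x2) // ltW.
have near_fu x : c <= x <= q -> \forall y \near x, f y = u y.
  move=> /andP[x1 x2]; near=> y; apply: fu; apply/andP; split; apply/ltW; near: y.
    by apply: lt_nbhsr; exact: lt_le_trans x1.
  by apply: lt_nbhsl; exact: le_lt_trans qq1.
have fu' x (xcq : c <= x <= q) : f x = u x := nbhs_singleton (near_fu x xcq).
exists f; split => //.
- apply: (C2_on_compact (c := c2) (d := q2)) => //.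
  + apply/andP; split=> //.
    have c2p : (c2%:E < p%:E)%E.
      by rewrite lte_fin (lt_trans c2c1) // (lt_trans c1c) // (le_lt_trans cq).
    exact: lt_le_trans pr.
  + apply/andP; split; last by rewrite (lt_le_trans _ pr).
    apply: (lt_trans lc2); rewrite lte_fin (lt_trans c2c1) // (lt_trans c1c) //.
    by rewrite (le_lt_trans cq) // (lt_trans qq1).
  + move=> x xK; rewrite /f; case: asboolP => // Ox.
    by rewrite chi0 ?mulr0.
- move=> x; rewrite /f; case: asboolP => Ox; last by rewrite normr0.
  rewrite normrM -[leRHS]mulr1; apply: ler_pM => //; first exact: uM.
  by have /andP[a1 a2] := chi01 x; rewrite ger0_norm.
- move=> x xcq; rewrite (diff_op_near a sigma (near_fu x xcq)) fu' //.
  apply: (bsol_eq bu); case/andP: xcq => x1 x2; apply: KO; rewrite /= in_itv /=.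
  rewrite (le_trans (ltW c2c1)) ?(le_trans (ltW c1c)) //=.
  by rewrite (le_trans x2) // ltW // (lt_trans qq1).
Unshelve. all: by end_near. Qed.

End TestFunctions.

(** * The Markov property for integrals *)

Section Mixture.
Local Open Scope ereal_scope.
Context d d' d'' (W : measurableType d) (X : measurableType d')
  (Y : measurableType d'') (R : realType).
Import HBNNSimple.

(** Passage from events to functions in the Markov property: [phi] is the later position and [k x]
    its law given the earlier state. Simple functions are settled by linearity, the others by
    monotone convergence. *)
Lemma ge0_integral_mixture (nu : {measure set W -> \bar R}) (E : set W)
    (phi : W -> Y) (mu : {measure set X -> \bar R}) (D : set X)
    (k : X -> {measure set Y -> \bar R}) (f : Y -> \bar R) :
  measurable E -> measurable_fun [set: W] phi -> measurable D ->
  (forall B, measurable B -> measurable_fun [set: X] (k ^~ B)) ->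
  (forall B, measurable B -> nu (E `&` phi @^-1` B) = \int[mu]_(x in D) k x B) ->
  (forall y, 0 <= f y) -> measurable_fun [set: Y] f ->
  \int[nu]_(w in E) f (phi w) = \int[mu]_(x in D) \int[k x]_y f y.
Proof.
move=> mE mphi mD mk nuE f0 mf.
have mkD B : measurable B -> measurable_fun D (k ^~ B).
  by move=> mB; apply: measurable_funTS; exact: mk.
have simple (h : {nnsfun Y >-> R}) :
    \int[nu]_(w in E) (h (phi w))%:E = \int[mu]_(x in D) \int[k x]_y (h y)%:E.
  have preh r : measurable (h @^-1` [set r]) by [].
  under [in RHS]eq_integral do rewrite integralT_nnsfun sintegralE.
  under eq_integral do rewrite fimfunE -fsumEFin//.
  rewrite /= ge0_integral_fsum//; last 2 first.
    - move=> r; apply/measurable_EFinP; apply: measurable_funTS.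
      apply: measurable_funM => //.
      have mi : measurable_fun [set: Y] (\1_(h @^-1` [set r]) : Y -> R).
        exact: measurable_indic.
      exact: (measurableT_comp mi mphi).
    - by move=> r z _; rewrite EFinM nnfun_muleindic_ge0.
  rewrite ge0_integral_fsum //; last 2 first.
    - by move=> r; apply: measurable_funeM; exact: mkD.
    - move=> r x _; have := mulemu_ge0 (fun n => h @^-1` [set n]).
      by apply; exact: preimage_nnfun0.
  apply: eq_fsbigr => r _.
  have mpre : measurable (phi @^-1` (h @^-1` [set r])).
    by rewrite -[X in measurable X]setTI; exact: mphi.
  rewrite (integralZl_indic mE (fun r => phi @^-1` (h @^-1` [set r])))//; last first.
    by move=> r0; rewrite preimage_nnfun0.
  rewrite integral_indic // setIC nuE //.
  (* A negative [r] is not a value of the nonnegative [h]: its preimage is empty and both sides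
     vanish. *)
  have [r0|r0] := leP 0%R r.
    by rewrite ge0_integralZl //; exact: mkD.
  rewrite preimage_nnfun0 // [in LHS]integral0_eq ?mule0 => [|x _]; last exact: measure0.
  by rewrite integral0_eq // => x _; rewrite measure0 mule0.
pose f_ := nnsfun_approx measurableT mf.
have f_cvg y : limn (fun n => (f_ n y)%:E) = f y.
  by apply/cvg_lim => //; exact: cvg_nnsfun_approx.
have f_nd y n m : (n <= m)%N -> (f_ n y)%:E <= (f_ m y)%:E.
  by move=> nm; rewrite lee_fin; exact/lefP/nd_nnsfun_approx.
have mono dZ (Z : measurableType dZ) (m : {measure set Z -> \bar R}) F (g : Z -> Y) :
    measurable F -> measurable_fun [set: Z] g ->
    \int[m]_(z in F) f (g z) = limn (fun n => \int[m]_(z in F) (f_ n (g z))%:E).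
  move=> mF mg; rewrite -monotone_convergence//.
  - by apply: eq_integral => y _; rewrite f_cvg.
  - move=> n; apply/measurable_EFinP; apply: measurable_funTS.
    exact: measurableT_comp.
  - by move=> n y _; rewrite lee_fin.
  - by move=> y _ n1 n2; exact: f_nd.
rewrite mono //; under [in RHS]eq_integral do rewrite (mono _ _ _ setT id) //.
rewrite monotone_convergence//.
- by congr (lim (_ @ \oo)); apply/funext => n; rewrite simple.
- move=> n; apply: measurable_funTS; apply: measurable_fun_integral_kernel => //.
  + by move=> y; rewrite lee_fin.
  + exact/measurable_EFinP.
- by move=> n x _; apply: integral_ge0 => y _; rewrite lee_fin.
- move=> x _ n m nm; apply: ge0_le_integral => //.
  + by move=> y _; rewrite lee_fin.
  + exact/measurable_EFinP.
  + exact/measurable_EFinP.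
  + by move=> y _; exact: f_nd.
Qed.

End Mixture.

Section Markov.
Context d (T : measurableType d) (R : realType).
Context (l r : \bar R) (a sigma : R -> R) (P : R -> probability T R) (X : R -> T -> R).
Hypothesis hX : regular_diffusion l r a sigma P X.

Lemma natural_filtration_measurable (t : R) (A : set T) :
  natural_filtration X t A -> measurable A.
Proof.
apply: smallest_sub; first exact: sigma_algebra_measurable.
move=> _ [u [B [/andP[u0 _] mB ->]]].
by rewrite -[X in measurable X]setTI; exact: (process_measurable hX).
Qed.

Lemma natural_filtration_homo (s t : R) (A : set T) : s <= t ->
  natural_filtration X s A -> natural_filtration X t A.
Proof.
move=> st; apply: sub_smallest2r; first exact: smallest_sigma_algebra.
move=> _ [u [B [/andP[u0 us] mB ->]]].
by exists u, B; split => //; rewrite u0 (le_trans us).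
Qed.

Lemma natural_filtration0 (t : R) : natural_filtration X t set0.
Proof. exact: sigma_algebra0. Qed.

Lemma natural_filtrationI (t : R) (A B : set T) : natural_filtration X t A ->
  natural_filtration X t B -> natural_filtration X t (A `&` B).
Proof.
move=> FA FB; have C D : natural_filtration X t D -> natural_filtration X t (~` D).
  by move=> FD; rewrite -setTD; exact: sigma_algebraCD.
rewrite -[A `&` B]setCK setCI; apply: (C); rewrite -bigcup2E.
by apply: sigma_algebra_bigcup => -[|[|n]]; [exact: C|exact: C|exact: sigma_algebra0].
Qed.

Lemma natural_filtration_preimage (t u : R) (B : set R) : 0 <= u <= t ->
  measurable B -> natural_filtration X t (X u @^-1` B).
Proof. by move=> ut mB; apply: sub_sigma_algebra; exists u, B. Qed.

Lemma state_space_measurable : measurable (state_space l r : set R).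
Proof. by apply: open_measurable; exact: state_space_open. Qed.

(** A constant time t is a stopping time, and the events of the filtration at t are prior to it; the
    finiteness events in [strong_Markov] then become trivial. *)
Lemma markov_measure (x t s : R) (A : set T) (B : set R) :
  state_space l r x -> 0 <= t -> 0 <= s -> natural_filtration X t A ->
  measurable B ->
  P x (A `&` X (t + s) @^-1` B) = (\int[P x]_(w in A) P (X t w) (X s @^-1` B))%E.
Proof.
move=> Dx t0 s0 FA mB.
have mA := natural_filtration_measurable FA.
have stop : stopping_time X (fun=> t%:E).
  split=> [w|u u0]; first by rewrite lee_fin.
  have [tu|ut] := leP t u.
    rewrite (_ : [set _ | _] = setT).
      by rewrite -(preimage_setT (X 0)); apply: natural_filtration_preimage;
        rewrite ?lexx.
    by apply/seteqP; split => // w _ /=; rewrite lee_fin.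
  rewrite (_ : [set _ | _] = set0); first exact: natural_filtration0.
  by apply/seteqP; split => // w /=; rewrite lee_fin leNgt ut.
have prior : prior_to X (fun=> t%:E) A.
  split=> // u u0; have [tu|ut] := leP t u.
    rewrite (_ : [set _ | _] = setT) ?setIT; first exact: natural_filtration_homo FA.
    by apply/seteqP; split => // w _ /=; rewrite lee_fin.
  rewrite (_ : [set _ | _] = set0) ?setI0; first exact: natural_filtration0.
  by apply/seteqP; split => // w /=; rewrite lee_fin leNgt ut.
have := diffusion_Markov hX Dx stop prior s0 mB.
have -> : A `&` [set w | (t%:E < +oo)%E] = A.
  by rewrite (_ : [set _ | _] = setT) ?setIT //; apply/seteqP; split => // w _ /=; rewrite ltry.
move=> <-; congr (P x _); apply/seteqP; split=> w /= [Aw] //; first by rewrite ltry.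
by case.
Qed.

Lemma markov_integral (x t s : R) (A : set T) (f : R -> \bar R) :
  state_space l r x -> 0 <= t -> 0 <= s -> natural_filtration X t A ->
  measurable_fun [set: R] f -> (forall y, 0 <= f y)%E ->
  measurable_fun [set: T] (fun w => \int[P (X t w)]_v f (X s v))%E /\
  (\int[P x]_(w in A) f (X (t + s) w) =
   \int[P x]_(w in A) \int[P (X t w)]_v f (X s v))%E.
Proof.
move=> Dx t0 s0 FA mf f0.
have mA := natural_filtration_measurable FA.
have ms := process_measurable hX s0.
have mts := process_measurable hX (addr_ge0 t0 s0).
have mt := process_measurable hX t0.
pose Xs : {mfun T >-> R} := HB.pack (X s) (isMeasurableFun.Build _ _ _ _ _ ms).
pose k w : {measure set R -> \bar R} := distribution (P (X t w)) Xs.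
have kE w : (\int[P (X t w)]_v f (X s v) = \int[k w]_y f y)%E.
  by rewrite ge0_integral_distribution.
have mk B : measurable B -> measurable_fun [set: T] (k ^~ B).
  (* The law is measurable in the starting point on D, and [X t] takes its values in D. *)
  move=> mB; apply/(measurable_comp (F := state_space l r) (f := fun y => P y (Xs @^-1` B))) => //.
  + exact: state_space_measurable.
  + by move=> _ [w _ <-]; exact: (paths_in_D hX).
  + by apply: (law_measurable hX); rewrite -[X in measurable X]setTI; exact: (process_measurable hX).
under [in RHS]eq_integral do rewrite kE.
split.
  under eq_fun do rewrite kE.
  exact: measurable_fun_integral_kernel.
rewrite (ge0_integral_mixture (phi := X (t + s)) (mu := P x) (D := A) (k := k) (f := f)) //.
by move=> B mB; exact: markov_measure.
Qed.

End Markov.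

(** * The discrete Dynkin formula *)

Section StoppedSum.
Context {R : realType} {T : Type}.
Implicit Types (Z : nat -> T -> R) (A : nat -> set T).

(* If A k = I 0 /\ ... /\ I k, this is Z stopped at the first k with ~ I k, and at N
   at the latest (stopped_sumP). *)
Definition stopped_sum Z A (N : nat) (w : T) : R :=
  Z 0%N w + \sum_(k < N) ((fun v => Z k.+1 v - Z k v) \_ (A k)) w.

(** The sum form suits integration, each increment living on an event known at its start. The index
    [k] restores the pathwise meaning, on which the uniform bound and the pathwise limit rest. *)
Lemma stopped_sumP Z (I : nat -> set T) (N : nat) (w : T) :
  exists k, [/\ (k <= N)%N,
    stopped_sum Z (fun k => [set v | forall j, (j <= k)%N -> I j v]) N w = Z k w,
    forall j, (j < k)%N -> I j w & k = N \/ ~ I k w].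
Proof.
elim: N => [|N [k [kN e hk hN]]].
  by exists 0%N; rewrite /stopped_sum big_ord0 addr0; split => //; left.
rewrite /stopped_sum big_ord_recr /= addrA; rewrite /stopped_sum in e; rewrite e.
rewrite patchE; case: ifPn => [|] hA.
  rewrite inE /= in hA.
  have kN' : k = N by case: hN => // nI; exfalso; apply: nI; exact: hA.
  exists N.+1; split => //; last by left.
  by rewrite kN' subrKC.
exists k; split => //; first exact: leqW.
  by rewrite addr0.
right; case: hN => // kN'; subst k => IN.
move/negP: hA; apply; rewrite inE /= => j; rewrite leq_eqVlt => /predU1P[->//|].
exact: hk.
Qed.

End StoppedSum.

Section MarkovBounded.
Context d (T : measurableType d) (R : realType).
Context (l r : \bar R) (a sigma : R -> R) (P : R -> probability T R) (X : R -> T -> R).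
Hypothesis hX : regular_diffusion l r a sigma P X.

Lemma bounded_Rintegrable (x M : R) (A : set T) (F : T -> R) :
  measurable A -> measurable_fun A F -> (forall w, `|F w| <= M) ->
  (P x).-integrable A (EFin \o F).
Proof.
move=> mA mF FM; apply: measurable_bounded_integrable => //.
  by rewrite (le_lt_trans (probability_le1 (P x) mA)) // ltry.
exists M; split; first exact: num_real.
by move=> y My w _; exact: le_trans (FM w) (ltW My).
Qed.

(** Adding [M] makes [f] nonnegative; under a probability measure the shift contributes exactly [M]
    to the inner expectation, so it cancels. The form of [m] is the one occurring in
    [has_generator]. *)
Lemma markov_Rintegral (x t s M : R) (A : set T) (f : R -> R) :
  state_space l r x -> 0 <= t -> 0 <= s -> natural_filtration X t A ->
  measurable_fun [set: R] f -> (forall y, `|f y| <= M) ->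
  let m y := fine 'E_(P y)[fun v => f (X s v)] in
  [/\ measurable_fun [set: T] (fun w => m (X t w)),
      forall y, `|m y| <= M &
      \int[P x]_(w in A) f (X (t + s) w) = \int[P x]_(w in A) m (X t w)].
Proof.
move=> Dx t0 s0 FA mf fM m.
have mA := natural_filtration_measurable hX FA.
have M0 : 0 <= M by rewrite (le_trans _ (fM 0)).
have mfs u : 0 <= u -> measurable_fun [set: T] (fun w => f (X u w)).
  by move=> u0; apply: measurableT_comp => //; exact: (process_measurable hX).
have mE y : m y = \int[P y]_v f (X s v) by rewrite /m unlock.
have intf y u (u0 : 0 <= u) : (P y).-integrable setT (EFin \o (fun v => f (X u v))).
  by apply: (@bounded_Rintegrable _ (M)) => //; exact: mfs.
have intc y (c : R) (B : set T) : measurable B -> (P y).-integrable B (EFin \o cst c).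
  by move=> mB; exact: finite_measure_integrable_cst.
have mM y : `|m y| <= M.
  rewrite mE (le_trans (le_normr_Rintegral _ _)) //; first exact: intf.
  rewrite (@le_trans _ _ (\int[P y]_v (cst M v))) //.
    apply: le_Rintegral => //; last exact: intc.
    by apply: integrable_norm; exact: intf.
  by rewrite Rintegral_cst // [X in fine X](probability_setT (P y)) mulr1.
have fp y : (0 <= (f y + M)%:E)%E.
  by rewrite lee_fin -lerBlDr sub0r; have /ler_normlP[] := fM y; rewrite lerNl.
have mfp : measurable_fun [set: R] (fun y => (f y + M)%:E).
  by apply/measurable_EFinP; exact: measurable_funD.
have [mk e] := markov_integral hX Dx t0 s0 FA mfp fp.
have RE y (B : set T) (F : T -> R) : (P y).-integrable B (EFin \o F) -> measurable B ->
    (\int[P y]_(v in B) (F v)%:E = (\int[P y]_(v in B) F v)%:E)%E.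
  by move=> iF mB; rewrite /Rintegral fineK //; exact: integrable_fin_num.
have mpE y : (\int[P y]_v (f (X s v) + M)%:E = (m y + M)%:E)%E.
  rewrite RE //; last first.
    apply: (@bounded_Rintegrable _ (M + M)) => //.
      by apply: measurable_funD => //; exact: mfs.
    by move=> w; rewrite (le_trans (ler_normD _ _)) // lerD // ger0_norm.
  rewrite RintegralD //; [|exact: intf|exact: (intc y M)].
  by rewrite Rintegral_cst // [X in fine X](probability_setT (P y)) mulr1 mE.
have mm : measurable_fun [set: T] (fun w => m (X t w)).
  have -> : (fun w => m (X t w)) = (fun w => (m (X t w) + M) - M).
    by apply/funext => w; rewrite addrK.
  apply: measurable_funB => //; apply/measurable_EFinP.
  by move: mk; under eq_fun do rewrite mpE.
split => //.
have t0s := addr_ge0 t0 s0.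
have i1 : (P x).-integrable A (EFin \o (fun w => f (X (t + s) w))).
  apply: (@bounded_Rintegrable _ (M)) => //.
  by apply: measurable_funTS; exact: mfs.
have i2 : (P x).-integrable A (EFin \o (fun w => m (X t w))).
  apply: (@bounded_Rintegrable _ (M)) => //.
  exact: measurable_funTS.
move: e; under [in RHS]eq_integral do rewrite mpE.
move=> /(congr1 fine); rewrite -!/(Rintegral _ _ _).
rewrite !RintegralD //; [|exact: (intc x M)..].
by move/addIr.
Qed.

End MarkovBounded.

Section DiscreteDynkinEstimate.
Context d (T : measurableType d) (R : realType).
Context (l r : \bar R) (a sigma : R -> R) (P : R -> probability T R) (X : R -> T -> R).
Hypothesis hX : regular_diffusion l r a sigma P X.

(** From 1 - z <= exp(-z) and 1 + z <= exp(z) follows 1 - z^2 <= exp(-z)(1 + z) <= 1. With z = rho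
    dt this measures how far the discount is from undoing the growth factor 1 + rho dt of one
    step. *)
Lemma expR_linear_error (z : R) : 0 <= z -> `|expR (- z) * (1 + z) - 1| <= z ^+ 2.
Proof.
move=> z0.
have h1 : 1 - z <= expR (- z) by rewrite expR_ge1Dx.
have h2 : expR (- z) * (1 + z) <= 1.
  by rewrite -[leRHS](expRxMexpNx_1 z) mulrC ler_wpM2r ?expR_ge0 // expR_ge1Dx.
rewrite ler0_norm ?subr_le0 // opprB lerBlDl -lerBlDr.
apply: (@le_trans _ _ ((1 - z) * (1 + z))).
  by rewrite le_eqVlt; apply/orP; left; apply/eqP; ring.
by rewrite ler_wpM2r // addr_ge0.
Qed.

Lemma norm_bound_ge0 (f : R -> R) (M : R) : (forall y, `|f y| <= M) -> 0 <= M.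
Proof. by move=> fM; rewrite (le_trans _ (fM 0)). Qed.

Lemma discounted_step (x t dt c q M e rho : R) (A : set T) (f : R -> R) :
  state_space l r x -> 0 <= t -> 0 < dt -> 0 <= rho -> 0 <= e -> natural_filtration X t A ->
  (forall w, A w -> c <= X t w <= q) ->
  measurable_fun [set: R] f -> (forall y, `|f y| <= M) ->
  (forall y, c <= y <= q ->
     `|(fine 'E_(P y)[fun v => f (X dt v)] - f y) / dt - rho * f y| <= e) ->
  `|\int[P x]_(w in A) (expR (- (rho * dt)) * f (X (t + dt) w) - f (X t w))| <=
    dt * (e + rho ^+ 2 * dt * M).
Proof.
move=> Dx t0 dt0 rho0 e0 FA Acq mf fM gen.
have M0 := norm_bound_ge0 fM.
have mA := natural_filtration_measurable hX FA.
pose m y := fine 'E_(P y)[fun v => f (X dt v)].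
have [mm mM mkv] : [/\ measurable_fun [set: T] (fun w => m (X t w)),
      forall y, `|m y| <= M &
      \int[P x]_(w in A) f (X (t + dt) w) = \int[P x]_(w in A) m (X t w)].
  exact: (markov_Rintegral hX Dx t0 (ltW dt0) FA mf fM).
have mfs u : 0 <= u -> measurable_fun A (fun w => f (X u w)).
  move=> u0; apply: measurable_funTS; apply: measurableT_comp => //.
  exact: (process_measurable hX).
have i1 u (u0 : 0 <= u) : (P x).-integrable A (EFin \o (fun w => f (X u w))).
  by apply: (@bounded_Rintegrable _ _ _ _ _ M) => //; exact: mfs.
have i2 : (P x).-integrable A (EFin \o (fun w => m (X t w))).
  by apply: (@bounded_Rintegrable _ _ _ _ _ M) => //; exact: measurable_funTS.
have iZ k (F : T -> R) : (P x).-integrable A (EFin \o F) ->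
    (P x).-integrable A (EFin \o (fun w => k * F w)).
  by move=> iF; have := integrableZl mA k iF; apply: eq_integrable.
have t0s := addr_ge0 t0 (ltW dt0).
rewrite RintegralB //; [|exact/iZ/i1|exact: i1].
rewrite RintegralZl //; last exact: i1.
rewrite mkv -RintegralZl // -RintegralB //; [|exact: iZ|exact: i1].
have iB : (P x).-integrable A
    (EFin \o (fun w => expR (- (rho * dt)) * m (X t w) - f (X t w))).
  by have := integrableB mA (iZ (expR (- (rho * dt))) _ i2) (i1 t t0);
    apply: eq_integrable.
apply: le_trans (le_normr_Rintegral mA iB) _.
set K := dt * _.
apply: (@le_trans _ _ (\int[P x]_(w in A) (cst K w))).
  apply: le_Rintegral => //.
  - exact: integrable_norm.
  - exact: finite_measure_integrable_cst.
  - move=> w /Acq; set y := X t w => yq /=.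
    (* The first term carries the generator error, at most dt e; the second the mismatch between
       discount and growth, at most (rho dt)^2 M. *)
    have -> : expR (- (rho * dt)) * m y - f y =
      expR (- (rho * dt)) * (dt * ((m y - f y) / dt - rho * f y)) +
      (expR (- (rho * dt)) * (1 + rho * dt) - 1) * f y.
      by field; rewrite gt_eqF.
    apply: le_trans (ler_normD _ _) _; rewrite /K [leRHS]mulrDr; apply: lerD.
      rewrite normrM ger0_norm ?expR_ge0 // normrM (gtr0_norm dt0).
      rewrite -[leRHS]mul1r; apply: ler_pM; rewrite ?expR_ge0 //.
      - by rewrite mulr_ge0 // ltW.
      - by rewrite -[leRHS](expR0 R) ler_expR oppr_le0 mulr_ge0 // ltW.
      - by rewrite ler_pM2l // gen.
    rewrite normrM (@le_trans _ _ ((rho * dt) ^+ 2 * M)) //.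
      by rewrite ler_pM // expR_linear_error // mulr_ge0 // ltW.
    by rewrite le_eqVlt; apply/orP; left; apply/eqP; ring.
rewrite Rintegral_cst // ler_piMr //.
  by apply: mulr_ge0; [exact: ltW|rewrite addr_ge0 // !mulr_ge0 ?sqr_ge0 // ltW].
by rewrite -lee_fin fineK ?probability_le1 // fin_num_measure.
Qed.

End DiscreteDynkinEstimate.

Section DiscreteDynkin.
Context d (T : measurableType d) (R : realType).
Context (l r : \bar R) (a sigma : R -> R) (P : R -> probability T R) (X : R -> T -> R).
Hypothesis hX : regular_diffusion l r a sigma P X.

Lemma ae_starts_at (x : R) : state_space l r x -> \forall w \ae P x, X 0 w = x.
Proof.
move=> Dx; have mE : measurable [set w | X 0 w = x].
  rewrite (_ : [set _ | _] = X 0 @^-1` [set x]) //.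
  by rewrite -[X in measurable X]setTI; exact: (process_measurable hX).
exists (~` [set w | X 0 w = x]); split => //; first exact: measurableC.
by rewrite probability_setC // (starts_at hX Dx) subee.
Qed.

Definition grid_cell (dt c q : R) (k : nat) : set T :=
  [set w | c <= X (k%:R * dt) w <= q].

Definition grid_cells (dt c q : R) (k : nat) : set T :=
  [set w | forall j, (j <= k)%N -> grid_cell dt c q j w].

Definition discounted (rho dt : R) (f : R -> R) (k : nat) (w : T) : R :=
  expR (- (rho * (k%:R * dt))) * f (X (k%:R * dt) w).

Lemma grid_cells_filtration (dt c q : R) (k : nat) : 0 <= dt ->
  natural_filtration X (k%:R * dt) (grid_cells dt c q k).
Proof.
move=> dt0; have cell j : natural_filtration X (j%:R * dt) (grid_cell dt c q j).
  rewrite (_ : grid_cell _ _ _ _ = X (j%:R * dt) @^-1` `[c, q]).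
    apply: natural_filtration_preimage; first by rewrite mulr_ge0 /=.
    exact: measurable_itv.
  by apply/seteqP; split => w /=; rewrite /grid_cell /= in_itv.
elim: k => [|k IH].
  rewrite (_ : grid_cells _ _ _ _ = grid_cell dt c q 0) //.
  by apply/seteqP; split => w /= h; [exact: h|move=> j; rewrite leqn0 => /eqP ->].
rewrite (_ : grid_cells _ _ _ _ = grid_cells dt c q k `&` grid_cell dt c q k.+1).
  apply: natural_filtrationI => //; apply: natural_filtration_homo IH.
  by rewrite ler_wpM2r // ler_nat.
apply/seteqP; split => w /= => [h|[h1 h2] j].
  by split => [j jk|]; apply: h => //; exact: leqW.
by rewrite leq_eqVlt => /predU1P[->//|]; exact: h1.
Qed.

(** Increment number k is integrated over an event known at time k dt on which X (k dt) lies in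
    [c, q], so [discounted_step] bounds it, and the errors add up over N steps. Where the exit step
    lands is immaterial, as [f] is bounded on the whole line. *)
Lemma discrete_dynkin (x dt c q M e rho : R) (f : R -> R) (N : nat) :
  state_space l r x -> 0 < dt -> 0 <= rho -> 0 <= e ->
  measurable_fun [set: R] f -> (forall y, `|f y| <= M) ->
  (forall y, c <= y <= q ->
     `|(fine 'E_(P y)[fun v => f (X dt v)] - f y) / dt - rho * f y| <= e) ->
  let S := stopped_sum (discounted rho dt f) (grid_cells dt c q) in
  [/\ measurable_fun [set: T] (S N), forall w, `|S N w| <= M &
    `|\int[P x]_w S N w - f x| <= N%:R * (dt * (e + rho ^+ 2 * dt * M))].
Proof.
move=> Dx dt0 rho0 e0 mf fM gen S.
have M0 := norm_bound_ge0 fM.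
have kdt k : 0 <= k%:R * dt by rewrite mulr_ge0 // ltW.
have mZ k : measurable_fun [set: T] (discounted rho dt f k).
  apply: measurable_funM => //; apply: measurableT_comp => //.
  exact: (process_measurable hX).
have ZM k w : `|discounted rho dt f k w| <= M.
  rewrite normrM ger0_norm ?expR_ge0 // -[leRHS]mul1r; apply: ler_pM; rewrite ?expR_ge0 //.
  by rewrite -[leRHS](expR0 R) ler_expR oppr_le0 mulr_ge0.
have SM n w : `|S n w| <= M.
  have [k [_ Sk _ _]] := stopped_sumP (discounted rho dt f) (grid_cell dt c q) n w.
  by have -> : S n w = discounted rho dt f k w := Sk.
have mcells k : measurable (grid_cells dt c q k).
  by apply: (natural_filtration_measurable hX); apply: grid_cells_filtration; exact: ltW.
pose D k w := discounted rho dt f k.+1 w - discounted rho dt f k w.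
have mD k : measurable_fun [set: T] (D k \_ (grid_cells dt c q k)).
  apply/(measurable_restrictT _ (mcells k)); apply: measurable_funTS.
  exact: measurable_funB.
have DM k w : `|D k w| <= M + M.
  by rewrite (le_trans (ler_normB _ _)) // lerD.
have SS n w : S n.+1 w = S n w + (D n \_ (grid_cells dt c q n)) w.
  by rewrite /S /stopped_sum big_ord_recr /= addrA.
have mS n : measurable_fun [set: T] (S n).
  elim: n => [|n IH].
    rewrite (_ : S 0%N = discounted rho dt f 0) //.
    by apply/funext => w; rewrite /S /stopped_sum big_ord0 addr0.
  rewrite (_ : S n.+1 = S n \+ (D n \_ (grid_cells dt c q n))); last first.
    by apply/funext => w; rewrite SS.
  exact: measurable_funD.
split => //; elim: N => [|N IH].
  rewrite mul0r; apply: (le_trans (y := 0)) => //; rewrite normr_le0 subr_eq0.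
  have -> : \int[P x]_w S 0%N w = \int[P x]_w f (X 0 w).
    apply: eq_Rintegral => w _; rewrite /S /stopped_sum big_ord0 addr0 /discounted.
    by rewrite mul0r mulr0 oppr0 expR0 mul1r.
  rewrite /Rintegral (ae_eq_integral (cst (f x)%:E)) //.
  - by rewrite integral_cst // [X in (_ * X)%E]probability_setT mule1.
  - apply/measurable_EFinP; apply: measurableT_comp => //.
    exact: (process_measurable hX).
  - by apply: filterS (ae_starts_at Dx) => w -> _.
have step : \int[P x]_w S N.+1 w = \int[P x]_w S N w +
    \int[P x]_(w in grid_cells dt c q N) D N w.
  under eq_Rintegral do rewrite SS.
  rewrite RintegralD // -?Rintegral_mkcond //.
  - exact: (@bounded_Rintegrable _ _ _ _ _ M).
  - apply: (@bounded_Rintegrable _ _ _ _ _ (M + M)) => // w.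
    by rewrite patchE; case: ifP => // _; rewrite normr0 addr_ge0.
rewrite step -natr1 mulrDl mul1r addrAC.
apply: le_trans (ler_normD _ _) _; apply: lerD => //.
have DE w : D N w = expR (- (rho * (N%:R * dt))) *
    (expR (- (rho * dt)) * f (X (N%:R * dt + dt) w) - f (X (N%:R * dt) w)).
  rewrite /D /discounted -natr1 mulrDl mul1r mulrDr opprD expRD mulrBr.
  by congr (_ - _); rewrite -[LHS]mulrA.
under eq_Rintegral do rewrite DE.
rewrite RintegralZl //; last first.
  apply: (@bounded_Rintegrable _ _ _ _ _ (M + M)) => //.
    apply: measurable_funTS; apply: measurable_funB.
      apply: measurable_funM => //; apply: measurableT_comp => //.
      by apply: (process_measurable hX); rewrite addr_ge0 // ltW.
    by apply: measurableT_comp => //; exact: (process_measurable hX).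
  move=> w; rewrite (le_trans (ler_normB _ _)) // lerD //.
  rewrite normrM ger0_norm ?expR_ge0 // -[leRHS]mul1r; apply: ler_pM; rewrite ?expR_ge0 //.
  by rewrite -[leRHS](expR0 R) ler_expR oppr_le0 mulr_ge0 // ltW.
rewrite normrM ger0_norm ?expR_ge0 // -[leRHS]mul1r; apply: ler_pM; rewrite ?expR_ge0 //.
  by rewrite -[leRHS](expR0 R) ler_expR oppr_le0 mulr_ge0.
apply: (discounted_step hX (c := c) (q := q)) => //.
  by apply: grid_cells_filtration; exact: ltW.
by move=> w; exact.
Qed.

End DiscreteDynkin.

(** * Convergence of the grid exit times *)

Section StoppedPath.
Context {R : realType}.
Implicit Types (y : R -> R) (q rho : R).

(** The strict inequality matters: for a continuous path the times with y t > q form an open set,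
    met by every fine enough grid if nonempty. A path merely touching q could escape all grids. *)
Definition first_above y q : \bar R :=
  ereal_inf [set t%:E | t in [set t : R | 0 <= t /\ q < y t]].

(** As [fine] sends +oo to 0, the exponential is 1 there; the second factor makes the discount of an
    infinite time equal to 0. *)
Definition discount rho (s : \bar R) : R :=
  expR (- (rho * fine s)) * ((s < +oo)%E)%:R.

Lemma first_above_ge0 y q : (0 <= first_above y q)%E.
Proof. by apply: le_ereal_inf_tmp => _ [t [t0 _] <-]; rewrite lee_fin. Qed.

Lemma before_first_above y q (t : R) :
  0 <= t -> (t%:E < first_above y q)%E -> y t <= q.
Proof.
move=> t0 ts; rewrite leNgt; apply/negP => qy.
have : (first_above y q <= t%:E)%E by apply: ereal_inf_lbound; exists t.
by rewrite leNgt ts.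
Qed.

Lemma after_first_above y q (s : R) : (first_above y q < s%:E)%E ->
  exists t, [/\ 0 <= t, t < s & q < y t].
Proof. by move=> /ereal_inf_lt[_ [t [t0 qy] <-]]; rewrite lte_fin => ts; exists t. Qed.

(** [Q] lies between z > q and z >= q, so that open and closed hitting times are treated together. A
    value above q at s would already occur earlier (s = 0 being excluded by y 0 <= q), and a value
    below q would exclude [Q] near s. *)
Lemma first_time_value y (Q : R -> Prop) q (s : R) : continuous y ->
  (forall z, q < z -> Q z) -> (forall z, Q z -> q <= z) -> y 0 <= q ->
  ereal_inf [set t%:E | t in [set t : R | 0 <= t /\ Q (y t)]] = s%:E -> y s = q.
Proof.
move=> cy Qgt Qge y0 es.
have s0 : 0 <= s.
  by rewrite -lee_fin -es; apply: le_ereal_inf_tmp => _ [t [t0 _] <-]; rewrite lee_fin.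
apply/eqP; rewrite eq_le; apply/andP; split; rewrite leNgt; apply/negP => h.
- have [s00|s0'] := eqVneq s 0; first by move: h; rewrite s00 ltNge y0.
  have spos : 0 < s by rewrite lt_neqAle eq_sym s0'.
  have near_s : \forall t \near s, q < y t by exact: (cvgr_gt _ (cy s)).
  have [e /= e0 he] := near_s.
  pose t := s - Num.min e s / 2.
  have m0 : 0 < Num.min e s by rewrite lt_min e0.
  have m2 : Num.min e s / 2 < Num.min e s by rewrite ltr_pdivrMr // ltr_pMr // ltr1n.
  have ts : t < s by rewrite ltrBlDr ltrDl divr_gt0.
  have t0 : 0 <= t by rewrite subr_ge0 (le_trans (ltW m2)) // ge_min lexx orbT.
  have qy : q < y t.
    apply: he; rewrite /= gtr0_norm ?subr_gt0 //.
    by rewrite /t opprB addrC subrK (lt_le_trans m2) // ge_min lexx.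
  have : (s%:E <= t%:E)%E by rewrite -es; apply: ereal_inf_lbound; exists t => //; split => //; exact: Qgt.
  by rewrite lee_fin leNgt ts.
- have near_s : \forall t \near s, y t < q by exact: (cvgr_lt _ (cy s)).
  have [e /= e0 he] := near_s.
  have : (ereal_inf [set t%:E | t in [set t : R | (0 <= t)%R /\ Q (y t)]] < (s + e)%:E)%E.
    by rewrite es lte_fin ltrDl.
  move=> /ereal_inf_lt[_ [t [t0 Qt] <-]]; rewrite lte_fin => ts.
  have st : s <= t.
    by rewrite -lee_fin -es; apply: ereal_inf_lbound; exists t.
  have : y t < q by apply: he; rewrite /= ler0_norm ?subr_le0 // opprB ltrBlDl.
  by rewrite ltNge Qge.
Qed.

Lemma first_above_value y q (s : R) : continuous y -> y 0 <= q ->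
  first_above y q = s%:E -> y s = q.
Proof.
by move=> cy y0; apply: (first_time_value (Q := fun z => q < z)) => // z; exact: ltW.
Qed.

Lemma grid_between (dt s eta : R) : 0 < dt -> dt < eta -> 0 <= s ->
  exists j : nat, s < j%:R * dt < s + eta.
Proof.
move=> dt0 dte s0; exists (Num.truncn (s / dt)).+1.
have /andP[h1 h2] := Num.Theory.truncn_itv (divr_ge0 s0 (ltW dt0)).
rewrite -ltr_pdivrMr // h2 /= -natr1 mulrDl mul1r.
by apply: ler_ltD dte; rewrite -ler_pdivlMr.
Qed.

(** For s < s_q the path on [0, s] is at most q and attains a minimum inside D, which [c_ n]
    eventually does not exceed; so the chain runs until s once the horizon exceeds s. Conversely a
    time t < s with y t > q has a neighbourhood of such times, into which a fine grid falls, and the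
    chain is stopped by then. *)
Lemma stopped_time_cvg l r y q (c_ dt_ : nat -> R) (kappa N : nat -> nat) :
  continuous y -> (forall t, state_space l r (y t)) ->
  (forall z, state_space l r z -> \forall n \near \oo, c_ n <= z) ->
  (forall n, 0 < dt_ n) -> dt_ n @[n --> \oo] --> 0 ->
  (forall n, n%:R <= (N n)%:R * dt_ n) ->
  (forall n j, (j < kappa n)%N -> y (j%:R * dt_ n) <= q) ->
  (forall n, kappa n = N n \/ ~ (c_ n <= y ((kappa n)%:R * dt_ n) <= q)) ->
  (forall s : R, (s%:E < first_above y q)%E ->
    \forall n \near \oo, s <= (kappa n)%:R * dt_ n) /\
  (forall s : R, (first_above y q < s%:E)%E ->
    \forall n \near \oo, (kappa n)%:R * dt_ n <= s).
Proof.
move=> cy yD hc dt0 dtcvg hN hk hstop; split => s hs.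
- have [s0|s0] := leP s 0.
    by near=> n; rewrite (le_trans s0) // mulr_ge0 // ltW.
  have [m m0 hm] := EVT_min (ltW s0) (continuous_subspaceT cy).
  near=> n; rewrite leNgt; apply/negP => ths.
  have th0 : 0 <= (kappa n)%:R * dt_ n by rewrite mulr_ge0 // ltW.
  case: (hstop n) => [kN|].
    have : n%:R < s by apply: le_lt_trans ths; rewrite kN.
    by rewrite ltNge => /negP; apply; near: n; exact: nbhs_infty_ger.
  apply; apply/andP; split.
    apply: (@le_trans _ _ (y m)); first by near: n; exact: hc.
    by apply: hm; rewrite in_itv /= th0 ltW.
  by apply: before_first_above => //; apply: lt_trans hs; rewrite lte_fin.
- have [t [t0 ts qy]] := after_first_above hs.
  have near_t : \forall z \near t, q < y z by exact: (cvgr_gt _ (cy t)).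
  have [e /= e0 he] := near_t.
  pose eta := Num.min e (s - t).
  have eta0 : 0 < eta by rewrite lt_min e0 subr_gt0.
  near=> n; rewrite leNgt; apply/negP => ths.
  have dte : dt_ n < eta.
    have : `|dt_ n| < eta by near: n; move/cvgr0Pnorm_lt: dtcvg; apply.
    by rewrite gtr0_norm.
  have [j /andP[tj je]] := grid_between (dt0 n) dte t0.
  have js : j%:R * dt_ n < s.
    apply: lt_le_trans je _; rewrite /eta -lerBrDl ge_min lexx orbT //.
  have jk : (j < kappa n)%N.
    by rewrite -(ltr_nat R) -(ltr_pM2r (dt0 n)) (lt_trans js).
  have := hk n j jk; apply/negP; rewrite -ltNge; apply: he.
  rewrite /= ltr0_norm ?subr_lt0 // opprB.
  by rewrite ltrBlDl (lt_le_trans je) // lerD2l /eta ge_min lexx.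
Unshelve. all: by end_near. Qed.

(** If s_q is finite, the stopping positions tend to y(s_q) = q, possibly from above: this overshoot
    is why f = u is required up to some q' > q. If s_q is infinite, the stopping times tend to
    infinity and the discount beats the bound [M]. *)
Lemma stopped_path_cvg l r y q q' rho M (u : R -> R) (f_ : nat -> R -> R)
    (c_ dt_ : nat -> R) (kappa N : nat -> nat) :
  0 < rho -> continuous y -> (forall t, state_space l r (y t)) ->
  y 0 <= q -> q < q' -> {for q, continuous u} ->
  (forall n z, `|f_ n z| <= M) ->
  (forall n z, c_ n <= z <= q' -> f_ n z = u z) ->
  (forall z, state_space l r z -> \forall n \near \oo, c_ n <= z) ->
  (forall n, 0 < dt_ n) -> dt_ n @[n --> \oo] --> 0 ->
  (forall n, n%:R <= (N n)%:R * dt_ n) ->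
  (forall n j, (j < kappa n)%N -> y (j%:R * dt_ n) <= q) ->
  (forall n, kappa n = N n \/ ~ (c_ n <= y ((kappa n)%:R * dt_ n) <= q)) ->
  expR (- (rho * ((kappa n)%:R * dt_ n))) * f_ n (y ((kappa n)%:R * dt_ n))
    @[n --> \oo] --> discount rho (first_above y q) * u q.
Proof.
move=> rho0 cy yD y0 qq' cu fM fu hc dt0 dtcvg hN hk hstop.
have [lo up] := stopped_time_cvg cy yD hc dt0 dtcvg hN hk hstop.
pose th n := (kappa n)%:R * dt_ n.
case: (first_above y q) lo up (first_above_ge0 y q) (fun s => @first_above_value y q s cy y0).
- move=> s lo up s0 /(_ s erefl) ys.
  have thc : th n @[n --> \oo] --> s.
    apply/cvgrPdist_le => e e0; near=> n; rewrite distrC ler_distl; apply/andP; split.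
      by near: n; apply: lo; rewrite lte_fin ltrBlDr ltrDl.
    by near: n; apply: up; rewrite lte_fin ltrDl.
  have yth : y (th n) @[n --> \oo] --> q.
    by rewrite -ys; apply: continuous_cvg => //; exact: cy.
  rewrite /discount /= ltry mulr1; apply: cvgM.
    apply: (@continuous_cvg _ _ _ _ _ _ (fun z => expR (- (rho * z)))) thc.
    apply: (@continuous_comp _ _ _ (fun z => - (rho * z)) expR); last exact: continuous_expR.
    by apply: cvgN; apply: cvgM; [exact: cvg_cst|exact: cvg_id].
  have fE : \forall n \near \oo, u (y (th n)) = f_ n (y (th n)).
    have Dq : state_space l r q by rewrite -ys.
    have /andP[lq qr] := Dq.
    have [z lz zq] := lte_dense_EFin lq.
    have Dz : state_space l r z.
      by apply/andP; split => //; rewrite (lt_trans _ qr) // lte_fin.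
    near=> n; rewrite fu //; apply/andP; split.
      apply: (@le_trans _ _ z); first by near: n; exact: hc.
      by apply/ltW; near: n; exact: (cvgr_gt _ yth).
    by apply/ltW; near: n; exact: (cvgr_lt _ yth).
  apply: cvg_trans (near_eq_cvg fE) _.
  by apply: continuous_cvg.
- move=> lo _ _ _; rewrite /discount ltxx mulr0 mul0r.
  have thy : rho * th n @[n --> \oo] --> +oo%R.
    apply/cvgryPge => A; near=> n.
    rewrite -ler_pdivrMl // mulrC; near: n; apply: lo; exact: ltry.
  have ec : expR (- (rho * th n)) * M @[n --> \oo] --> 0.
    rewrite -[X in _ --> X](mul0r M); apply: cvgM; last exact: cvg_cst.
    exact: (cvg_comp _ _ thy (@cvgr_expR R)).
  apply: norm_cvg0; apply: (squeeze_cvgr _ (cvg_cst 0) ec).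
  near=> n; rewrite normr_ge0 /= normrM ger0_norm ?expR_ge0 //.
  by rewrite ler_wpM2l ?expR_ge0.
- by move=> _ _ /=; rewrite leNgt ltNyr.
Unshelve. all: by end_near. Qed.

End StoppedPath.

(** * Laplace transforms of passage times *)

Section PassageTime.
Context d (T : measurableType d) (R : realType).
Context (l r : \bar R) (a sigma : R -> R) (P : R -> probability T R) (X : R -> T -> R).
Hypothesis hX : regular_diffusion l r a sigma P X.

Definition passage_time (q : R) (w : T) : \bar R := first_above (X ^~ w) q.

(** Holding the path at its initial value for negative times makes it continuous on the whole line,
    so that limits and extrema can be taken without restricting to t >= 0. *)
Lemma extended_path_continuous (w : T) : continuous (fun t : R => X (Num.max 0 t) w).
Proof.
move=> t; have : {within [set t : R | 0 <= t], continuous (fun t => X t w)}.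
  exact: (paths_continuous hX).
move=> /subspace_continuousP /(_ (Num.max 0 t)).
have t0 : [set t : R | 0 <= t] (Num.max 0 t) by rewrite /= le_max lexx.
move=> /(_ t0) ct; apply: cvg_trans ct => A /= hA.
have cm : Num.max 0 (z : R) @[z --> t] --> Num.max 0 t.
  exact: (@continuous_max R R (cst 0) id t (@cst_continuous R R 0 t) (fun _ h => h)).
have hz : \forall z \near t, 0 <= Num.max 0 z -> A (X (Num.max 0 z) w) := cm _ hA.
suff : \forall z \near t, A (X (Num.max 0 z) w) by [].
by near=> z; apply: (near hz z) => //; rewrite le_max lexx.
Unshelve. all: by end_near.
Qed.

Lemma passage_time_extended (q : R) (w : T) :
  passage_time q w = first_above (fun t => X (Num.max 0 t) w) q.
Proof.
rewrite /passage_time /first_above; congr ereal_inf; congr (image _ _).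
by apply/seteqP; split => t /= [t0 qX]; rewrite max_r // in qX *.
Qed.

(** By continuity, the path exceeds q before time s if and only if it does so at some rational time
    j/(m+1) < s, which leaves a countable union. *)
Lemma measurable_passage_time (q : R) : measurable_fun [set: T] (passage_time q).
Proof.
have mX t B : 0 <= t -> measurable B -> measurable (X t @^-1` B).
  move=> t0 mB; rewrite -[X in measurable X]setTI.
  exact: (process_measurable hX t0).
move=> _; apply: (measurability _ (ErealGenInftyO.measurableE R)) => //.
move=> _ [_ [s ->] <-]; rewrite setTI.
rewrite [X in measurable X](_ : _ = \bigcup_j \bigcup_m
   (if j%:R / m.+1%:R < s then X (j%:R / m.+1%:R) @^-1` `]q, +oo[ else set0)); last first.
  apply/seteqP; split => w /=.
    rewrite in_itv /= passage_time_extended => /after_first_above[t [t0 ts qX]].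
    have near_t : \forall z \near t, q < X (Num.max 0 z) w.
      exact: (cvgr_gt _ (@extended_path_continuous w t)).
    have [e /= e0 he] := near_t.
    have [m hm] : exists m : nat, m.+1%:R^-1 < Num.min e (s - t).
      have m0 : 0 < Num.min e (s - t) by rewrite lt_min e0 subr_gt0.
      exists (Num.truncn (Num.min e (s - t))^-1).
      by rewrite invf_plt ?posrE // Num.Theory.truncnS_gt.
    have m0 : 0 < m.+1%:R^-1 :> R by rewrite invr_gt0.
    have [j /andP[tj jm]] := grid_between m0 hm t0.
    exists j => //; exists m => //.
    rewrite ifT; last first.
      by rewrite (lt_le_trans jm) // -lerBrDl ge_min lexx orbT.
    rewrite /= in_itv /= andbT.
    have j0 : 0 <= j%:R / m.+1%:R :> R by rewrite divr_ge0.
    rewrite -[j%:R / _](max_r j0); apply: he.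
    rewrite /= ltr0_norm ?subr_lt0 // opprB ltrBlDl.
    by rewrite (lt_le_trans jm) // lerD2l ge_min lexx.
  move=> [j _ [m _]]; case: ifPn => // js; rewrite /= !in_itv /= andbT => qX.
  apply: (@le_lt_trans _ _ (j%:R / m.+1%:R)%:E); last by rewrite lte_fin.
  by apply: ereal_inf_lbound; exists (j%:R / m.+1%:R) => //; split; rewrite ?divr_ge0.
apply: bigcup_measurable => j _; apply: bigcup_measurable => m _.
by case: ifP => // _; apply: mX; rewrite ?divr_ge0.
Qed.

Lemma measurable_discount (rho : R) (tau : T -> \bar R) :
  measurable_fun [set: T] tau -> measurable_fun [set: T] (fun w => discount rho (tau w)).
Proof.
move=> mt; apply: measurable_funM.
  apply: measurableT_comp => //; apply: measurableT_comp => //.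
  apply: measurable_funM => //; apply: measurableT_comp mt.
  exact: fine_measurable.
rewrite (_ : (fun w => _) = \1_[set w | (tau w < +oo)%E]).
  apply: measurable_indic; rewrite -[X in measurable X]setTI.
  exact: emeasurable_fun_infty_o.
apply/funext => w; rewrite indicE.
by have -> : (w \in [set w | (tau w < +oo)%E]) = (tau w < +oo)%E
  by apply/idP/idP; rewrite inE.
Qed.

Lemma discount01 (rho : R) (s : \bar R) : 0 <= rho -> (0 <= s)%E -> 0 <= discount rho s <= 1.
Proof.
move=> rho0 s0; rewrite /discount mulr_ge0 ?expR_ge0 //=.
have : expR (- (rho * fine s)) <= 1.
  by rewrite -[leRHS](expR0 R) ler_expR oppr_le0 mulr_ge0 // fine_ge0.
by case: (s < +oo)%E; rewrite ?mulr1 ?mulr0.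
Qed.

Lemma state_space_exhausted (x : R) : (l < x%:E)%E ->
  exists c : nat -> R, (forall n, (l < (c n)%:E)%E /\ c n <= x) /\
    forall z, (l < z%:E)%E -> \forall n \near \oo, c n <= z.
Proof.
case: l => [l0| |] //=.
- rewrite lte_fin => lx; exists (fun n => l0 + (x - l0) / n.+1%:R); split => [n|z].
    have h : 0 < (x - l0) / n.+1%:R by rewrite divr_gt0 // subr_gt0.
    rewrite lte_fin ltrDl h; split => //.
    by rewrite -lerBrDl ler_pdivrMr // ler_peMr ?subr_ge0 ?(ltW lx) // ler1n.
  rewrite lte_fin => lz; near=> n.
  rewrite -lerBrDl ler_pdivrMr // -ler_pdivrMl ?subr_gt0 //.
  rewrite (@le_trans _ _ n%:R) // ?ler_nat //.
  by near: n; exact: nbhs_infty_ger.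
- move=> _; exists (fun n => x - n%:R); split => [n|z _].
    by split; [exact: ltNyr|rewrite gerBl].
  near=> n; rewrite lerBlDr -lerBlDl; near: n; exact: nbhs_infty_ger.
Unshelve. all: by end_near. Qed.

End PassageTime.

Section Laplace.
Context d (T : measurableType d) (R : realType).
Context (l r : \bar R) (a sigma : R -> R) (P : R -> probability T R) (X : R -> T -> R).
Hypothesis hX : regular_diffusion l r a sigma P X.

Lemma approximate_dynkin (rho p q q' x c M : R) (u : R -> R) (n : nat) :
  0 < rho -> (p%:E <= r)%E -> bounded_solution l a sigma rho u p ->
  (forall z, state_space l p%:E z -> `|u z| <= M) ->
  (l < c%:E)%E -> c <= x -> x <= q -> q <= q' -> q' < p ->
  exists (f : R -> R) (dt : R) (N : nat),
  let S := stopped_sum (discounted X rho dt f) (grid_cells X dt c q) N in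
  [/\ (forall z, `|f z| <= M) /\ (forall z, c <= z <= q' -> f z = u z),
      0 < dt /\ dt <= n.+1%:R^-1, n%:R <= N%:R * dt,
      measurable_fun [set: T] S /\ (forall w, `|S w| <= M) &
      `|\int[P x]_w S w - u x| <= (1 + rho ^+ 2 * M) / n.+1%:R].
Proof.
move=> rho0 pr bu uM lc cx xq qq qp.
have xq' := le_trans xq qq; have cq := le_trans cx xq'.
have pr' (z : R) : (l < z%:E)%E -> z <= q' -> state_space l r z.
  move=> lz zq; rewrite /state_space /= lz /= (lt_le_trans _ pr) // lte_fin.
  exact: le_lt_trans qp.
have lx : (l < x%:E)%E by rewrite (lt_le_trans lc) ?lee_fin.
have Dx := pr' x lx xq'.
have Dc := pr' c lc cq.
have Dq : state_space l r q' by apply: pr' => //; rewrite (lt_le_trans lx) ?lee_fin.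
have [f [fC fM fu fL]] := bounded_solution_test (drift_continuous hX)
  (sigma_continuous hX) (sigma_gt0 hX) pr bu uM lc cq qp.
(* The horizon has to grow like n while the errors add up over it, hence the precision (n+1)^-2 both
   for the generator and for dt. *)
have n0 : 0 < n.+1%:R^-1 ^+ 2 :> R by rewrite exprn_gt0 // invr_gt0.
have [d0 /= d00 hd] := diffusion_generator hX fC Dc Dq n0.
pose m := (Num.truncn (Num.max d0^-1 (n.+1%:R ^+ 2))).
have hm : Num.max d0^-1 (n.+1%:R ^+ 2) < m.+1%:R := Num.Theory.truncnS_gt _.
pose dt : R := m.+1%:R^-1.
have dt0 : 0 < dt by rewrite invr_gt0.
have dtd : dt < d0.
  by rewrite /dt invf_plt ?posrE // (le_lt_trans _ hm) // le_max lexx.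
have dtn : dt <= n.+1%:R^-1 ^+ 2.
  by rewrite /dt exprVn lef_pV2 ?posrE // ?exprn_gt0 // (le_trans _ (ltW hm)) // le_max lexx orbT.
(* With dt = 1/(m+1) this number of steps gives the horizon n + 1 exactly, and a total error of at
   most (n+1)((n+1)^-2 + rho^2 (n+1)^-2 M). *)
exists f, dt, (n.+1 * m.+1)%N.
have Ndt : (n.+1 * m.+1)%N%:R * dt = n.+1%:R by rewrite /dt natrM mulfK.
have M0 := norm_bound_ge0 fM.
have fx : f x = u x by apply: fu; rewrite cx xq'.
have mf : measurable_fun [set: R] f.
  have cf : continuous f.
    move=> z; apply: is_derive1_continuous; apply: derivable_is_derive1.
    exact: (@C2c_derivable1 _ _ _ fC z).
  exact: continuous_measurable_fun.
have gen y : c <= y <= q ->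
    `|(fine 'E_(P y)[fun v => f (X dt v)] - f y) / dt - rho * f y| <= n.+1%:R^-1 ^+ 2.
  move=> /andP[yc yq]; have ycq : c <= y <= q' by rewrite yc (le_trans yq).
  rewrite -(fL y ycq); apply: hd => //.
  by rewrite /= sub0r normrN gtr0_norm.
have [mS SM Se] := discrete_dynkin hX (n.+1 * m.+1)%N Dx dt0 (ltW rho0) (ltW n0) mf fM gen.
split => //.
- split => //; apply: le_trans dtn _; rewrite expr2 ler_piMr ?invr_ge0 //.
  by rewrite invf_le1 // ler1n.
- by rewrite Ndt ler_nat.
- rewrite -fx; apply: le_trans Se _; rewrite mulrA Ndt.
  apply: (@le_trans _ _ (n.+1%:R * (n.+1%:R^-1 ^+ 2 + rho ^+ 2 * n.+1%:R^-1 ^+ 2 * M))).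
    rewrite ler_wpM2l // lerD2l ler_wpM2r // ler_wpM2l // sqr_ge0 //.
  rewrite le_eqVlt; apply/orP; left; apply/eqP; field.
  by rewrite nat1r pnatr_eq0.
Qed.

(** The integrals of the stopped sums tend to u(x) by the Dynkin estimate, and to the right-hand
    side by dominated convergence with the constant [M]. The transform on the right does not depend
    on [u], so two bounded solutions can be compared through it. *)
Lemma laplace_passage_time (rho p q x : R) (u : R -> R) :
  0 < rho -> (p%:E <= r)%E -> bounded_solution l a sigma rho u p ->
  (l < x%:E)%E -> x <= q -> q < p ->
  u x = \int[P x]_w discount rho (passage_time X q w) * u q.
Proof.
move=> rho0 pr bu lx xq qp.
have Dx : state_space l r x.
  rewrite /state_space /= lx /= (lt_le_trans _ pr) // lte_fin; exact: le_lt_trans qp.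
have [M uM] := bsol_bounded bu.
pose q' := (q + p) / 2.
have [qq' q'p] : q < q' /\ q' < p by rewrite !midf_lt.
have xq' : x <= q' := le_trans xq (ltW qq').
have [c_ [hc1 hc2]] := state_space_exhausted lx.
have ex n : exists v : (R -> R) * R * nat,
  let: (f, dt, N) := v in
  let S := stopped_sum (discounted X rho dt f) (grid_cells X dt (c_ n) q) N in
  [/\ (forall z, `|f z| <= M) /\ (forall z, c_ n <= z <= q' -> f z = u z),
      0 < dt /\ dt <= n.+1%:R^-1, n%:R <= N%:R * dt,
      measurable_fun [set: T] S /\ (forall w, `|S w| <= M) &
      `|\int[P x]_w S w - u x| <= (1 + rho ^+ 2 * M) / n.+1%:R].
  have [lc cx] := hc1 n.
  have [f [dt [N h]]] := approximate_dynkin n rho0 pr bu uM lc cx xq (ltW qq') q'p.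
  by exists (f, dt, N).
have [v hv] := choice ex.
pose f_ n := (v n).1.1; pose dt_ n := (v n).1.2; pose N n := (v n).2.
pose S n := stopped_sum (discounted X rho (dt_ n) (f_ n)) (grid_cells X (dt_ n) (c_ n) q) (N n).
have {hv ex} hv n : [/\ (forall z, `|f_ n z| <= M) /\ (forall z, c_ n <= z <= q' -> f_ n z = u z),
      0 < dt_ n /\ dt_ n <= n.+1%:R^-1, n%:R <= (N n)%:R * dt_ n,
      measurable_fun [set: T] (S n) /\ (forall w, `|S n w| <= M) &
      `|\int[P x]_w S n w - u x| <= (1 + rho ^+ 2 * M) / n.+1%:R].
  by have := hv n; rewrite /S /f_ /dt_ /N; case: (v n) => [[f dt] N'].
have mS n : measurable_fun [set: T] (S n) by have [_ _ _ []] := hv n.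
have SM n w : `|S n w| <= M by have [_ _ _ [_]] := hv n; exact.
have M0 : 0 <= M by rewrite (le_trans _ (SM 0%N point)).
have invn : (n.+1%:R^-1 : R) @[n --> \oo] --> (0 : R) by exact: cvg_harmonic.
have dtcvg : dt_ n @[n --> \oo] --> 0.
  apply: (squeeze_cvgr _ (cvg_cst 0) invn); near=> n.
  by have [_ [d0 ->] _ _ _] := hv n; rewrite ltW.
have cu : {for q, continuous u}.
  apply: is_derive1_continuous (derivable_is_derive1 (bsol_derivable1 bu _)).
  by rewrite /state_space /= lte_fin qp (lt_le_trans lx) // lee_fin.
have path w : X 0 w = x -> S n w @[n --> \oo] --> discount rho (passage_time X q w) * u q.
  move=> X0; pose y t := X (Num.max 0 t) w.
  have exk n : exists k, [/\ S n w = discounted X rho (dt_ n) (f_ n) k w,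
      forall j, (j < k)%N -> grid_cell X (dt_ n) (c_ n) q j w &
      k = N n \/ ~ grid_cell X (dt_ n) (c_ n) q k w].
    have [k [_ h1 h2 h3]] := stopped_sumP (discounted X rho (dt_ n) (f_ n))
      (grid_cell X (dt_ n) (c_ n) q) (N n) w.
    by exists k.
  have [kappa hk] := choice exk.
  have dt0 n : 0 < dt_ n by have [_ [? _] _ _ _] := hv n.
  have yE n k : y (k%:R * dt_ n) = X (k%:R * dt_ n) w.
    by rewrite /y max_r // mulr_ge0 // ltW.
  have := @stopped_path_cvg _ l r y q q' rho M u f_ c_ dt_ kappa N rho0.
  rewrite -passage_time_extended.
  have -> : (fun n => expR (- (rho * ((kappa n)%:R * dt_ n))) * f_ n (y ((kappa n)%:R * dt_ n)))
      = S ^~ w.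
    by apply/funext => n; have [-> _ _] := hk n; rewrite yE.
  apply => //.
  - exact: (extended_path_continuous hX).
  - by move=> t; apply: (paths_in_D hX); rewrite le_max lexx.
  - by rewrite /y maxxx X0.
  - by move=> n z; have [[h _] _ _ _ _] := hv n; exact: h.
  - by move=> n z; have [[_ h] _ _ _ _] := hv n; exact: h.
  - by move=> z /andP[lz _]; exact: hc2.
  - by move=> n; have [_ _ h _ _] := hv n.
  - by move=> n j jk; have [_ h _] := hk n; have /andP[_] := h j jk; rewrite yE.
  - by move=> n; have [_ _] := hk n; rewrite yE.
have mlim : measurable_fun [set: T] (fun w => discount rho (passage_time X q w)).
  exact: measurable_discount (measurable_passage_time hX q).
have Slim : (\int[P x]_w (S n w)%:E)%E @[n --> \oo] -->
    (\int[P x]_w (discount rho (passage_time X q w) * u q)%:E)%E.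
  have h1 n : measurable_fun [set: T] (fun w => (S n w)%:E) by apply/measurable_EFinP.
  have h2 : measurable_fun [set: T]
      (fun w => (discount rho (passage_time X q w) * u q)%:E).
    by apply/measurable_EFinP; exact: measurable_funM.
  have h3 : \forall w \ae P x, [set: T] w -> (S n w)%:E @[n --> \oo] -->
      (discount rho (passage_time X q w) * u q)%:E.
    apply: filterS (ae_starts_at hX Dx) => w X0 _.
    by apply: cvg_EFin; [exact: nearW|exact: path].
  have h4 : (P x).-integrable setT (EFin \o cst M) by exact: finite_measure_integrable_cst.
  have h5 : \forall w \ae P x, forall n, [set: T] w ->
      (`|(S n w)%:E| <= (EFin \o cst M) w)%E.
    by apply: aeW => w n _; rewrite /= lee_fin.
  by have [_ _] := dominated_convergence measurableT h1 h2 h3 h4 h5.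
have Su : (\int[P x]_w (S n w)%:E)%E @[n --> \oo] --> (u x)%:E.
  have -> : (fun n => (\int[P x]_w (S n w)%:E)%E) = (fun n => (\int[P x]_w S n w)%:E).
    apply/funext => n; rewrite /Rintegral fineK //; apply: integrable_fin_num => //.
    exact: (@bounded_Rintegrable _ _ _ _ _ M).
  apply: cvg_EFin; first exact: nearW.
  have ec : (1 + rho ^+ 2 * M) / n.+1%:R @[n --> \oo] --> 0.
    by rewrite -[X in _ --> X](mulr0 (1 + rho ^+ 2 * M)); apply: cvgM invn; exact: cvg_cst.
  apply/cvgrPdist_le => e e0; near=> n.
  have [_ _ _ _] := hv n; rewrite distrC => /le_trans; apply.
  by apply/ltW; near: n; exact: (cvgr_lt _ ec).
have uE : (u x)%:E = (\int[P x]_w (discount rho (passage_time X q w) * u q)%:E)%E.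
  exact: (cvg_unique _ Su Slim).
rewrite -RintegralZr //.
  by rewrite /Rintegral -uE.
apply: (@bounded_Rintegrable _ _ _ _ _ 1) => // w.
have /andP[h0 h1] := discount01 (ltW rho0) (first_above_ge0 (X ^~ w) q).
by rewrite ger0_norm.
Unshelve. all: try by end_near.
Qed.

End Laplace.

(** * Payoffs of threshold times *)

Section Payoff.
Context d (T : measurableType d) (R : realType).
Context (l r : \bar R) (a sigma : R -> R) (P : R -> probability T R) (X : R -> T -> R).
Hypothesis hX : regular_diffusion l r a sigma P X.

Lemma threshold_time_ge0 (p : R) (w : T) : (0 <= threshold_time X p w)%E.
Proof. by apply: le_ereal_inf_tmp => _ [t [t0 _] <-]; rewrite lee_fin. Qed.

Lemma passage_time_le_threshold (p q : R) (w : T) : q < p ->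
  (passage_time X q w <= threshold_time X p w)%E.
Proof.
move=> qp; apply: le_ereal_inf => _ [t [t0 pX] <-]; exists t => //; split => //.
exact: lt_le_trans pX.
Qed.

Lemma threshold_le_passage_time (p : R) (w : T) :
  (threshold_time X p w <= passage_time X p w)%E.
Proof.
by apply: le_ereal_inf => _ [t [t0 pX] <-]; exists t => //; split => //; exact: ltW.
Qed.

Lemma threshold_time_value (p s : R) (w : T) : X 0 w <= p ->
  threshold_time X p w = s%:E -> X s w = p.
Proof.
move=> X0 es; have s0 : 0 <= s by rewrite -lee_fin -es threshold_time_ge0.
have -> : X s w = X (Num.max 0 s) w by rewrite max_r.
apply: (first_time_value (y := fun t => X (Num.max 0 t) w) (Q := fun z => p <= z)) => //.
- exact: (extended_path_continuous hX).
- by move=> z /ltW.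
- by rewrite maxxx.
- rewrite -es; congr ereal_inf; congr (image _ _).
  by apply/seteqP; split => t /= [t0 qX]; rewrite max_r // in qX *.
Qed.

(** The time tau_p exceeds s exactly when s_q does for some q = p - 1/(m+1): a path staying below p
    on a compact time interval stays below some such q. *)
Lemma measurable_threshold_time (p : R) : measurable_fun [set: T] (threshold_time X p).
Proof.
move=> _; apply: (measurability _ (ErealGenOInfty.measurableE R)) => //.
move=> _ [_ [s ->] <-]; rewrite setTI.
rewrite [X in measurable X](_ : _ = \bigcup_m
   (passage_time X (p - m.+1%:R^-1) @^-1` `]s%:E, +oo[)); last first.
  apply/seteqP; split => w /=; last first.
    move=> [m _]; rewrite /= !in_itv /= !andbT => /lt_le_trans; apply.
    by apply: passage_time_le_threshold; rewrite ltrBlDr ltrDl invr_gt0.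
  rewrite in_itv /= andbT => sth.
  have [s0|s0] := ltP s 0.
    exists 0%N => //; rewrite /= in_itv /= andbT.
    by apply: (lt_le_trans (y := 0%E)); rewrite ?lte_fin // first_above_ge0.
  (* An intermediate time: the compactness argument on [0, s'] yields a passage time of at least s',
     and more than s is needed. *)
  have [s' ss' s'th] : exists2 s', s < s' & (s'%:E < threshold_time X p w)%E.
    case: (threshold_time X p w) sth => [t| |//].
    + by rewrite lte_fin => st; exists ((s + t) / 2); rewrite ?lte_fin midf_lt.
    + by move=> _; exists (s + 1); rewrite ?ltrDl // ltry.
  have s'0 : 0 <= s' by rewrite (le_trans s0) // ltW.
  have [m0 m0s hm] := EVT_max s'0 (continuous_subspaceT (@extended_path_continuous _ _ _ _ _ _ _ _ _ hX w)).
  have below t : 0 <= t <= s' -> X t w < p.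
    move=> /andP[t0 ts]; rewrite ltNge; apply/negP => pX.
    have : (threshold_time X p w <= t%:E)%E by apply: ereal_inf_lbound; exists t.
    by rewrite leNgt (le_lt_trans _ s'th) // lee_fin.
  have mp : X (Num.max 0 m0) w < p.
    by move: m0s; rewrite in_itv /= => /andP[h1 h2]; rewrite max_r // below // h1.
  set z := X (Num.max 0 m0) w in hm mp.
  exists (Num.truncn (p - z)^-1) => //=; rewrite in_itv /= andbT.
  apply: (lt_le_trans (y := s'%:E)); first by rewrite lte_fin.
  apply: le_ereal_inf_tmp => _ [t [t0 qX] <-]; rewrite lee_fin leNgt; apply/negP => ts.
  have := hm t; rewrite in_itv /= t0 (ltW ts) max_r // => /(_ isT).
  rewrite leNgt => /negP; apply; apply: le_lt_trans qX.
  rewrite lerBrDl -lerBrDr; apply/ltW; rewrite invf_plt ?posrE ?subr_gt0 //.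
  exact: Num.Theory.truncnS_gt.
apply: bigcup_measurable => m _; rewrite -[X in measurable X]setTI.
by apply: (measurable_passage_time hX) => //; exact: emeasurable_itv.
Qed.

Lemma discount_anti (rho : R) (s t : \bar R) : 0 <= rho -> (0 <= s)%E -> (s <= t)%E ->
  discount rho t <= discount rho s.
Proof.
rewrite /discount => rho0; case: s => [s| |//]; case: t => [t| |//] //= s0.
- rewrite lee_fin => st; rewrite !ltry !mulr1 ler_expR lerN2 ler_wpM2l //.
- by move=> _; rewrite mulr0 ltry mulr1 expR_ge0.
Qed.

Lemma fundamental_bounded_solution (rho : R) (psi : R -> R) (p : R) :
  increasing_fundamental l r a sigma rho psi -> state_space l r p ->
  bounded_solution l a sigma rho psi p.
Proof.
move=> hpsi Dp; have sub : state_space l p%:E `<=` state_space l r.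
  move=> z /andP[lz zp]; apply/andP; split=> //; apply: lt_trans zp _.
  by case/andP: Dp.
split.
- exists (psi p) => z Dz; have Dz' := sub z Dz.
  rewrite gtr0_norm ?(fund_gt0 hpsi) // ltW // (fund_increasing hpsi) //.
  by case/andP: Dz.
- by move=> z /sub; exact: (fund_derivable1 hpsi).
- by move=> z /sub; exact: (fund_derivable2 hpsi).
- by move=> z /sub; exact: (fund_eq hpsi).
Qed.

(** Discounting reverses the order of s_q <= tau_p <= s_p, so the transform lies between
    psi(x)/psi(p) and psi(x)/psi(q) for every q in [x, p); continuity of psi at p closes the gap. *)
Lemma laplace_threshold (rho : R) (psi : R -> R) (p x : R) :
  0 < rho -> increasing_fundamental l r a sigma rho psi ->
  state_space l r x -> state_space l r p -> x < p ->
  \int[P x]_w discount rho (threshold_time X p w) = psi x / psi p.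
Proof.
move=> rho0 hpsi Dx Dp xp.
(* The passage formula requires a solution beyond the level; with [p1] > p it is available at the
   level p itself. *)
have [p1 pp1 p1r] : exists2 p1 : R, p < p1 & (p1%:E < r)%E.
  case/andP: Dp => _; case: (r) => [r'| |//].
  + by rewrite lte_fin => st; exists ((p + r') / 2); rewrite ?lte_fin midf_lt.
  + by move=> _; exists (p + 1); rewrite ?ltrDl // ltry.
have Dp1 : state_space l r p1.
  apply/andP; split => //; case/andP: Dp => lp _; apply: lt_trans lp _; exact: pp1.
have lx : (l < x%:E)%E by case/andP: Dx.
have bu := fundamental_bounded_solution hpsi Dp1.
have Lq q : x <= q <= p -> \int[P x]_w discount rho (passage_time X q w) = psi x / psi q.
  move=> /andP[xq qp].
  have Dq : state_space l r q by apply: (state_space_itv Dx Dp); rewrite xq.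
  have pq := fund_gt0 hpsi Dq.
  by rewrite (laplace_passage_time hX rho0 (ltW p1r) bu lx xq (le_lt_trans qp pp1))
    mulfK // gt_eqF.
have bint (tau : T -> \bar R) : measurable_fun [set: T] tau -> (forall w, 0 <= tau w)%E ->
    (P x).-integrable setT (EFin \o (fun w => discount rho (tau w))).
  move=> mt t0; apply: (@bounded_Rintegrable _ _ _ _ _ 1) => //.
    exact: measurable_discount.
  move=> w; have /andP[h0 h1] := discount01 (ltW rho0) (t0 w).
  by rewrite ger0_norm.
have i1 q : (P x).-integrable setT (EFin \o (fun w => discount rho (passage_time X q w))).
  by apply: bint; [exact: (measurable_passage_time hX)|move=> w; exact: first_above_ge0].
have i2 := bint _ (measurable_threshold_time p) (threshold_time_ge0 p).
set L := \int[P x]_w _.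
have Lge : psi x / psi p <= L.
  have xpp : x <= p <= p by rewrite lexx ltW.
  rewrite -(Lq p xpp); apply: le_Rintegral => // w _.
  apply: discount_anti; [exact: ltW|exact: threshold_time_ge0|].
  exact: threshold_le_passage_time.
have Lle q : x <= q < p -> L <= psi x / psi q.
  move=> /andP[xq qp]; have xqp : x <= q <= p by rewrite xq ltW.
  rewrite -(Lq q xqp); apply: le_Rintegral => // w _.
  apply: discount_anti; [exact: ltW|exact: first_above_ge0|].
  exact: passage_time_le_threshold.
have pp0 := fund_gt0 hpsi Dp; have px0 := fund_gt0 hpsi Dx.
have L0 : 0 < L by apply: lt_le_trans Lge; rewrite divr_gt0.
apply/eqP; rewrite eq_le Lge andbT leNgt; apply/negP => hL.
have : psi x / L < psi p by rewrite ltr_pdivrMr // mulrC -ltr_pdivrMr.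
have cp : {for p, continuous psi}.
  by apply: is_derive1_continuous; apply: derivable_is_derive1; exact: (fund_derivable1 hpsi).
move=> h; have [q [xq qp hq]] : exists q, [/\ x < q, q < p & psi x / L < psi q].
  have near_p : \forall q \near p, psi x / L < psi q by exact: (cvgr_gt _ cp).
  have [e /= e0 he] := near_p.
  have m0 : 0 < Num.min e (p - x) by rewrite lt_min e0 subr_gt0.
  have m2 : Num.min e (p - x) / 2 < Num.min e (p - x) by rewrite ltr_pdivrMr // ltr_pMr // ltr1n.
  exists (p - Num.min e (p - x) / 2); split.
  - by rewrite ltrBrDl -ltrBrDr (lt_le_trans m2) // ge_min lexx orbT.
  - by rewrite ltrBlDr ltrDl divr_gt0.
  - apply: he; rewrite /= opprB addrC subrK gtr0_norm ?divr_gt0 //.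
    by rewrite (lt_le_trans m2) // ge_min lexx.
have Dq : state_space l r q by apply: (state_space_itv Dx Dp); rewrite !ltW.
have pq := fund_gt0 hpsi Dq.
have := Lle q; rewrite qp ltW // => /(_ isT).
by rewrite leNgt ltr_pdivrMr // mulrC -ltr_pdivrMr // hq.
Qed.

End Payoff.

(** * Threshold payoffs and free-boundary solutions in terms of g / psi *)

Section FreeBoundaryPayoff.
Context d (T : measurableType d) (R : realType).
Context (l r : \bar R) (a sigma : R -> R) (P : R -> probability T R) (X : R -> T -> R).
Hypothesis hX : regular_diffusion l r a sigma P X.
Context (rho : R) (psi g : R -> R).
Hypotheses (rho0 : 0 < rho) (hpsi : increasing_fundamental l r a sigma rho psi)
  (hg : forall x, state_space l r x -> derivable g x 1).

Lemma payoff_threshold (p x : R) : state_space l r p -> state_space l r x ->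
  payoff P X g rho x (threshold_time X p) =
  (g (Num.max p x) / psi (Num.max p x) * psi x)%:E.
Proof.
move=> Dp Dx; rewrite /payoff unlock.
(* A form of the payoff without the position at a random time: a path starting at or above p stops
   at once, a path starting below is at p when it stops. Measurability can be read off it. *)
pose F w := if p <= X 0 w then g (X 0 w) else g p * discount rho (threshold_time X p w).
have FE w : g (X (fine (threshold_time X p w)) w) *
    expR (- (rho * fine (threshold_time X p w))) *
    \1_[set v | (threshold_time X p v < +oo)%E] w = F w.
  have -> : \1_[set v | (threshold_time X p v < +oo)%E] w =
      ((threshold_time X p w < +oo)%E)%:R :> R.
    rewrite indicE; congr ((nat_of_bool _)%:R); by apply/idP/idP; rewrite inE.
  rewrite /F; case: ifPn => [pX|].
    have -> : threshold_time X p w = 0%E.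
      apply/eqP; rewrite eq_le threshold_time_ge0 andbT.
      by apply: ereal_inf_lbound; exists 0.
    by rewrite ltry /= mulr0 oppr0 expR0 !mulr1.
  rewrite -ltNge => Xp; rewrite -mulrA -/(discount _ _).
  case e : (threshold_time X p w) => [s| |] /=.
  - by rewrite (threshold_time_value hX (ltW Xp) e).
  - by rewrite /discount ltxx !mulr0.
  - by have := threshold_time_ge0 X p w; rewrite e.
under eq_integral do rewrite FE.
have mX0 : measurable_fun [set: T] (X 0) by exact: (process_measurable hX).
have mF : measurable_fun [set: T] F.
  apply: measurable_fun_ifT.
  - exact: (measurable_fun_ler (@measurable_cst _ _ _ _ setT p) mX0).
  - apply: (measurable_comp (F := state_space l r)) mX0.
    + exact: state_space_measurable.
    + by move=> _ [w _ <-]; exact: (paths_in_D hX).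
    + apply: open_continuous_measurable_fun; first exact: state_space_open.
      move=> z /[1!inE] Dz; apply: is_derive1_continuous.
      by apply: derivable_is_derive1; exact: hg.
  - apply: measurable_funM => //; apply: measurable_discount.
    exact: (measurable_threshold_time hX).
have ps0 := fund_gt0 hpsi Dx.
have mFE : measurable_fun [set: T] (EFin \o F) by exact/measurable_EFinP.
have [px|xp] := leP p x.
  rewrite divfK ?gt_eqF //.
  rewrite (ae_eq_integral (cst (g x)%:E)) //.
    by rewrite integral_cst // [X in (_ * X)%E]probability_setT mule1.
  by apply: filterS (ae_starts_at hX Dx) => w X0 _; rewrite /= /F X0 px.
have mD : measurable_fun [set: T] (fun w => discount rho (threshold_time X p w)).
  apply: measurable_discount; exact: (measurable_threshold_time hX).
rewrite (ae_eq_integral (fun w => (g p * discount rho (threshold_time X p w))%:E)) //.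
- have iD : (P x).-integrable setT (EFin \o (fun w => discount rho (threshold_time X p w))).
    apply: (@bounded_Rintegrable _ _ _ _ _ 1) => // w.
    have /andP[h0 h1] := discount01 (ltW rho0) (threshold_time_ge0 X p w).
    by rewrite ger0_norm.
  have iG : (P x).-integrable setT
      (EFin \o (fun w => g p * discount rho (threshold_time X p w))).
    by have := integrableZl measurableT (g p) iD; apply: eq_integrable.
  rewrite -(fineK (integrable_fin_num measurableT iG)) -/(Rintegral _ _ _).
  by rewrite RintegralZl // (laplace_threshold hX rho0 hpsi Dx Dp xp) mulrA mulrAC.
- by apply/measurable_EFinP; exact: measurable_funM.
- by apply: filterS (ae_starts_at hX Dx) => w X0 _; rewrite /= /F X0 leNgt xp.
Qed.

Lemma near_left_state_space (p : R) : (l < p%:E)%E ->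
  \forall x \near p^'-, state_space l p%:E x.
Proof.
move=> lp; have [z lz zp] := lte_dense_EFin lp; near=> x.
apply/andP; split; last by rewrite lte_fin; near: x; exact: nbhs_left_lt.
by apply: (lt_trans lz); rewrite lte_fin; near: x; exact: nbhs_left_gt.
Unshelve. all: by end_near. Qed.

Lemma fundamental_continuous (p : R) : state_space l r p -> {for p, continuous psi}.
Proof.
move=> Dp; apply: is_derive1_continuous; apply: derivable_is_derive1.
exact: (fund_derivable1 hpsi).
Qed.

Lemma fundamental_derive1_continuous (p : R) : state_space l r p -> {for p, continuous (derive1 psi)}.
Proof.
move=> Dp; apply: is_derive1_continuous; apply: derivable_is_derive1.
exact: (fund_derivable2 hpsi).
Qed.

(** Eliminating E^x exp(-rho s_q) between the formulas for [H] and [psi] gives H(x) psi(q) = H(q)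
    psi(x). Then q increases to p, where H has the limit g(p). *)
Lemma fb_solution_proportional (H : R -> R) (p x : R) :
  fb_solution l r a sigma rho g H p -> state_space l p%:E x ->
  H x = g p / psi p * psi x.
Proof.
move=> [Dp Hb H1 H2 He Hv _] /andP[lx xp]; rewrite lte_fin in xp.
have pr : (p%:E <= r)%E by case/andP: Dp => _ /ltW.
have bH : bounded_solution l a sigma rho H p by [].
have bpsi := fundamental_bounded_solution hpsi Dp.
have e : \forall q \near p^'-, H x * psi q = H q * psi x.
  near=> q.
  have xq : x <= q by near: q; exact: nbhs_left_ge.
  have qp : q < p by near: q; exact: nbhs_left_lt.
  rewrite (laplace_passage_time hX rho0 pr bH lx xq qp).
  rewrite [in RHS](laplace_passage_time hX rho0 pr bpsi lx xq qp).
  by ring.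
have c1 : H x * psi q @[q --> p^'-] --> H x * psi p.
  by apply: cvgMr; apply: cvg_at_left_filter; exact: fundamental_continuous.
have c2 : H q * psi x @[q --> p^'-] --> g p * psi x by apply: cvgMl.
have eq1 : H x * psi p = g p * psi x.
  apply: (@cvg_unique _ (@Rhausdorff R) _ _ _ _ _ c2).
  by apply: cvg_trans c1; apply: near_eq_cvg; apply: filterS e => q.
by rewrite mulrAC -eq1 mulfK // gt_eqF // (fund_gt0 hpsi).
Unshelve. all: by end_near. Qed.

Lemma near_left_proportional (H : R -> R) (p : R) :
  fb_solution l r a sigma rho g H p ->
  \forall x \near p^'-, H x = g p / psi p * psi x.
Proof.
move=> hH; have /andP[lp _] := fb_threshold hH.
by apply: filterS (near_left_state_space lp) => x; exact: fb_solution_proportional.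
Qed.

Lemma fb_solution_critical (H : R -> R) (p : R) :
  fb_solution l r a sigma rho g H p -> g p / psi p * derive1 psi p = derive1 g p.
Proof.
move=> hH; have Dp := fb_threshold hH.
have /andP[lp pr] := Dp.
have c1 : g p / psi p * derive1 psi q @[q --> p^'-] --> g p / psi p * derive1 psi p.
  by apply: cvgMr; apply: cvg_at_left_filter; exact: fundamental_derive1_continuous.
apply: (@cvg_unique _ (@Rhausdorff R) _ _ _ _ _ (fb_smooth_fit hH)).
apply: cvg_trans c1; apply: near_eq_cvg.
have dn : \forall x \near p, forall k, (k.+1 < 2)%N -> derivable (derive1n k psi) x 1.
  have : \forall x \near p, state_space l r x.
    by apply: open_nbhs_nbhs; split => //; exact: state_space_open.
  by apply: filterS => x Dx [|//] _; exact: (fund_derivable1 hpsi).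
apply: filterS (derive1n_left_scale dn (near_left_proportional hH) (isT : 1 < 2)%N) => x h; exact: (esym h).
Qed.

(** Turns any further critical point of g / psi into a solution to which the assumption on the other
    free-boundary solutions applies. *)
Lemma critical_fb_solution (p : R) : state_space l r p ->
  g p / psi p * derive1 psi p = derive1 g p ->
  fb_solution l r a sigma rho g (fun x => g p / psi p * psi x) p.
Proof.
move=> Dp crit; set k := g p / psi p.
have [[M hM] d1 d2 ee] := fundamental_bounded_solution hpsi Dp.
have /andP[lp pr] := Dp.
have sc (f : R -> R) (x : R) : derivable f x 1 -> is_derive x (1 : R) (fun y => k * f y) (k * derive1 f x).
  move=> df; have := is_deriveM (is_derive_cst k x (1 : R)) (derivable_is_derive1 df).
  by move=> h; apply: (is_derive_eq h); rewrite /= scaler0 addr0.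
have D1 (x : R) : derivable psi x 1 -> derive1 (fun y => k * psi y) x = k * derive1 psi x.
  by move=> /sc /is_derive1_derive1.
have near_D1 x : state_space l p%:E x ->
    \forall y \near x, k * derive1 psi y = derive1 (fun y => k * psi y) y.
  move=> Ox; have : \forall y \near x, state_space l p%:E y.
    by apply: open_nbhs_nbhs; split => //; exact: state_space_open.
  by apply: filterS => y /d1 /D1.
split.
- exact: Dp.
- by exists (`|k| * M) => x /hM h; rewrite normrM ler_wpM2l.
- by move=> x /d1 /sc[].
- move=> x Ox; apply: near_eq_derivable (near_D1 x Ox) _.
  by have [] := sc _ _ (d2 x Ox).
- move=> x Ox; rewrite /diff_op /derive1n /= D1; last exact: d1.
  have -> : derive1 (derive1 (fun y => k * psi y)) x = k * derive1 (derive1 psi) x.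
    apply: is_derive1_derive1.
    exact: (near_eq_is_derive (near_D1 x Ox) (sc _ _ (d2 x Ox))).
  have := ee x Ox; rewrite /diff_op /derive1n /= => e1.
  by rewrite [RHS]mulrCA -e1; ring.
- have -> : g p = k * psi p by rewrite /k divfK // gt_eqF // (fund_gt0 hpsi).
  by apply: cvgMr; apply: cvg_at_left_filter; exact: fundamental_continuous.
- rewrite -crit; have c1 : k * derive1 psi q @[q --> p^'-] --> k * derive1 psi p.
    by apply: cvgMr; apply: cvg_at_left_filter; exact: fundamental_derive1_continuous.
  apply: cvg_trans c1; apply: near_eq_cvg.
  by apply: filterS (near_left_state_space lp) => x /d1 /D1.
Qed.

Lemma fb_solution_gap (H : R -> R) (p : R) (n : nat) : (1 < n)%N ->
  fb_solution l r a sigma rho g H p ->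
  times_derivable_at n psi p -> times_derivable_at n g p ->
  times_derivable_left n H p ->
  (forall k, (2 <= k <= n.-1)%N -> derive1n k H x @[x --> p^'-] --> derive1n k g p) ->
  left_derivn_gt n H g p ->
  exists2 e : R, 0 < e &
    (forall x, p < x < p + e -> g x < g p / psi p * psi x) /\
    (n = 2%N -> forall x, p - e < x < p -> g x < g p / psi p * psi x).
Proof.
move=> n1 hH psin gn Hn vk Hgt.
apply: (smooth_fit_gap n1 psin gn Hn (near_left_proportional hH)) => //.
- by rewrite divfK // gt_eqF // (fund_gt0 hpsi) //; exact: (fb_threshold hH).
- exact: fb_solution_critical hH.
Qed.

(** At order 2 the differentiability of [psi] and [H] is part of their being solutions, and there is
    no intermediate derivative to match. The gap on the left of p serves the case of a unique
    solution. *)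
Lemma fb_solution_gap_second_order (H : R -> R) (p : R) :
  fb_solution l r a sigma rho g H p ->
  times_derivable_at 2 g p -> left_derivn_gt 2 H g p ->
  exists2 e : R, 0 < e &
    (forall x, p < x < p + e -> g x < g p / psi p * psi x) /\
    (forall x, p - e < x < p -> g x < g p / psi p * psi x).
Proof.
move=> hH g2 Hgt; have Dp := fb_threshold hH; have /andP[lp _] := Dp.
have [||k|e e0 [h1 h2]] := fb_solution_gap (n := 2) isT hH _ g2 _ _ Hgt.
- split; last exact: (fund_derivable2 hpsi).
  have : \forall x \near p, state_space l r x.
    by apply: open_nbhs_nbhs; split => //; exact: state_space_open.
  by apply: filterS => x Dx [|//] _; exact: (fund_derivable1 hpsi).
- apply: filterS (near_left_state_space lp) => x Ox [|[|//]] _.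
    exact: (fb_derivable1 hH).
  exact: (fb_derivable2 hH).
- by case: k => [//|[//|k]] /andP[].
- by exists e => //; split => //; exact: h2.
Qed.

End FreeBoundaryPayoff.

(** * Comparison of g / psi at the threshold with its other values *)

Theorem proposition2 (d : measure_display) (T : measurableType d)
    (R : realType) (l r : \bar R) (a sigma : R -> R)
    (P : R -> probability T R) (X : R -> T -> R)
    (rho : R) (psi g H : R -> R) (pstar : R)
    (hlr : (l < r)%E)
    (hX : regular_diffusion l r a sigma P X)
    (hrho : 0 < rho)
    (hpsi : increasing_fundamental l r a sigma rho psi)
    (hg : forall x, state_space l r x -> derivable g x 1)
    (hg0 : exists2 x0, state_space l r x0 & 0 < g x0)
    (hsol : fb_solution l r a sigma rho g H pstar)
    (hg2 : times_derivable_at 2 g pstar)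
    (hH2 : left_derivn_gt 2 H g pstar)
    (hcond :
      (forall (H' : R -> R) (p' : R), fb_solution l r a sigma rho g H' p' ->
        same_solution l H' p' H pstar)
      \/
      [/\ (exists (H' : R -> R) (p' : R),
             fb_solution l r a sigma rho g H' p' /\
             ~ same_solution l H' p' H pstar),
          (forall x, state_space l pstar%:E x -> g x <= H x)
        & (forall (H' : R -> R) (p' : R),
             fb_solution l r a sigma rho g H' p' ->
             ~ same_solution l H' p' H pstar ->
             p' < pstar \/
             (pstar < p' /\ higher_order_fit psi H' g p'))]) :
  optimal_in (threshold_class l r X) l r P X g rho
    (threshold_time X pstar).
Proof.
have Dp := fb_threshold hsol.
have psi0 := fund_gt0 hpsi.
have dpsi := fund_derivable1 hpsi.
have [e e0 [gapr gapl]] := fb_solution_gap_second_order hX hrho hpsi hsol hg2 hH2.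
have crit := fb_solution_critical hX hrho hpsi hsol.
pose h x := g x / psi x.
have right q : state_space l r q -> pstar <= q ->
    g q / psi q * derive1 psi q = derive1 g q ->
    exists2 e : R, 0 < e & forall x, q < x < q + e -> g x < g q / psi q * psi x.
  rewrite le_eqVlt => Dq /predU1P[<- _|pq cq]; first by exists e.
  (* A critical point q > pstar carries a solution other than (H, pstar). Uniqueness excludes it;
     otherwise the condition of order n gives the decrease after q, the alternative q < pstar being
     absurd. *)
  have fbq := critical_fb_solution hpsi Dq cq.
  have nsame : ~ same_solution l (fun x => g q / psi q * psi x) q H pstar.
    by move=> [qp _]; move: pq; rewrite qp ltxx.
  case: hcond => [uniq|[_ _ other]]; first by case: nsame; exact: uniq.
  have [qp|[_ [n [n2 [h1 h2 h3 h4 h5]]]]] := other _ _ fbq nsame.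
    by move: (lt_trans pq qp); rewrite ltxx.
  have [e' e'0 [gap _]] := fb_solution_gap hX hrho hpsi (ltnW n2) fbq h1 h2 h3 h4 h5.
  by exists e'.
have hnonincr x y : state_space l r y -> pstar <= x <= y -> h y <= h x.
  exact: (ratio_nonincreasing dpsi hg psi0 Dp crit right).
have hleft q : state_space l r q -> q < pstar -> h q <= h pstar.
  move=> Dq qp; case: hcond => [uniq|[_ gH _]].
    rewrite leNgt; apply/negP => hq.
    (* [z] lies just left of pstar, where h(z) < h(pstar) by the second-order condition. As h(q) >
       h(pstar), the minimum of h over [q, pstar] is interior and yields a second solution. *)
    pose z := pstar - Num.min e (pstar - q) / 2.
    have m0 : 0 < Num.min e (pstar - q) by rewrite lt_min e0 subr_gt0.
    have m2 : Num.min e (pstar - q) / 2 < Num.min e (pstar - q).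
      by rewrite ltr_pdivrMr // ltr_pMr // ltr1n.
    have zp : z < pstar by rewrite ltrBlDr ltrDl divr_gt0.
    have qz : q <= z by rewrite lerBrDl -lerBrDr (le_trans (ltW m2)) // ge_min lexx orbT.
    have ze : pstar - e < z by rewrite ltrD2l ltrN2 (lt_le_trans m2) // ge_min lexx.
    have Dz : state_space l r z by apply: (state_space_itv Dq Dp); rewrite qz ltW.
    have hz : h z < h pstar by rewrite ltr_pdivrMr ?psi0 // gapl // ze.
    have qpp : q <= pstar <= pstar by rewrite lexx ltW.
    have qzp : q <= z <= pstar by rewrite qz ltW.
    have [m [/andP[qm mp] cm _]] :=
      ratio_interior_min dpsi hg psi0 Dq Dp qpp qzp hq hz.
    have Dm : state_space l r m by apply: (state_space_itv Dq Dp); rewrite !ltW.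
    have [mE _] := uniq _ _ (critical_fb_solution hpsi Dm cm).
    by move: mp; rewrite mE ltxx.
  (* Here H = h(pstar) psi on (l, pstar), so the assumption g <= H is the claim itself. *)
  rewrite ler_pdivrMr ?psi0 // -(fb_solution_proportional hX hrho hpsi hsol).
    apply: gH; case/andP: Dq => lq _; apply/andP; split => //; by rewrite lte_fin.
  by case/andP: Dq => lq _; apply/andP; split => //; rewrite lte_fin.
split; first by exists pstar.
move=> x Dx; apply/eqP; rewrite eq_le; apply/andP; split.
  by apply: ereal_sup_ubound; exists (threshold_time X pstar) => //; exists pstar.
apply: ge_ereal_sup => _ [_ [q Dq <-] <-].
rewrite !(payoff_threshold hX hrho hpsi hg) // lee_fin; apply: ler_wpM2r; first exact: ltW (psi0 x Dx).
change (h (Num.max q x) <= h (Num.max pstar x)).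
have Dm u v : state_space l r u -> state_space l r v -> state_space l r (Num.max u v).
  by move=> Du Dv; case: (leP u v).
(* If x >= pstar, both arguments of h are at least pstar, where h is nonincreasing. Otherwise
   max(pstar, x) = pstar, and max(q, x) may lie on either side of it. *)
have [px|xp] := leP pstar x.
  apply: hnonincr; first exact: Dm.
  by rewrite px le_max lexx orbT.
have [pq|qp] := leP pstar (Num.max q x); last by apply: hleft => //; exact: Dm.
by apply: hnonincr; [exact: Dm|rewrite lexx].
Qed.
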